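(* (Legendre condition.) Let $t_0<t_1$, $0<\alpha\le 1$, $\beta>0$, $x_0,x_1\in\mathbb{R}^n$, and let $L=L(t,x,y)$ be a real function of $2n+1$ variables ($t\in\mathbb{R}$, $x,y\in\mathbb{R}^n$). Consider the problem ($P_2$): extremize $$J(x(\cdot))=\int_{t_0}^{t_1}(t_1-t)^{\beta-1}L\big(t,x(t),({}^{c}D^{\alpha}_{t_0+}x)(t)\big)\,dt,\qquad x(t_0)=x_0,\quad x(t_1)=x_1,$$ over $x\in PC^{\alpha}([t_0,t_1],\mathbb{R}^n)$. Let $x^0\in PC^{\alpha}([t_0,t_1],\mathbb{R}^n)$ be admissible, let $T$ be the set of continuity points of ${}^{c}D^{\alpha}_{t_0+}x^0$ in $[t_0,t_1]$, and suppose that $L,L_x,L_y$ are continuous in some neighborhood of the graph $\{(t,x^0(t),({}^{c}D^{\alpha}_{t_0+}x^0)(t)):t\in[t_0,t_1]\}$ and that $L$ is twice differentiable with respect to $y$ at the points of the set $\{(t,x^0(t),({}^{c}D^{\alpha}_{t_0+}x^0)(t)):t\in T\}$. If $x^0$ provides a weak local minimum in ($P_2$), then for every $t\in T$ and every $\mu\in\mathbb{R}^n$ $$\big\langle L_{yy}\big(t,x^0(t),({}^{c}D^{\alpha}_{t_0+}x^0)(t)\big)\mu,\mu\big\rangle\ge 0.$$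
   Context: $PC([t_0,t_1],\mathbb{R}^n)$ is the set of piecewise continuous functions: continuous on $[t_0,t_1]$ except at finitely many points of $(t_0,t_1)$, where they have discontinuities of the first kind (finite one-sided limits). For $\alpha>0$: $(I^{\alpha}_{t_0+}\varphi)(t)=\frac{1}{\Gamma(\alpha)}\int_{t_0}^{t}(t-\tau)^{\alpha-1}\varphi(\tau)\,d\tau$. For $0<\alpha<1$ and continuous $\varphi$: $({}^{c}D^{\alpha}_{t_0+}\varphi)(t)=\frac{d}{dt}\big(I^{1-\alpha}_{t_0+}(\varphi(\cdot)-\varphi(t_0))\big)(t)$; for $\alpha=1$ it is the ordinary derivative. $PC^{\alpha}([t_0,t_1],\mathbb{R}^n)$ is the set of all continuous $\varphi$ with $\varphi(t)=\varphi(t_0)+(I^{\alpha}_{t_0+}\psi)(t)$ on $[t_0,t_1]$ for some $\psi\in PC([t_0,t_1],\mathbb{R}^n)$; then ${}^{c}D^{\alpha}_{t_0+}\varphi=\psi$ at the continuity points of $\psi$. Norm: $\|y\|_{PC^{\alpha}}=\|y\|_{C}+\|{}^{c}D^{\alpha}_{t_0+}y\|_{L^{\infty}}$. A function $x\in PC^{\alpha}([t_0,t_1],\mathbb{R}^n)$ is admissible if $x(t_0)=x_0$, $x(t_1)=x_1$. An admissible $x^0$ provides a weak local minimum if there is $\delta>0$ such that $J(x(\cdot))\ge J(x^0(\cdot))$ for every admissible $x$ with $\|x-x^0\|_{PC^{\alpha}}<\delta$. At a discontinuity point $t$ of ${}^{c}D^{\alpha}_{t_0+}x^0$ the graph is understood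 to contain both points $(t,x^0(t),({}^{c}D^{\alpha}_{t_0+}x^0)(t\pm0))$. $L_x,L_y$ denote the gradients in $x$ and $y$, $L_{yy}$ the Hessian in $y$; $\langle\cdot,\cdot\rangle$ is the scalar product. *)

(* Defs.v *)
From HB Require Import structures.
From mathcomp Require Import all_boot all_order all_algebra.
From mathcomp Require Import all_classical all_reals all_analysis ess_sup_inf.

Set Implicit Arguments.
Unset Strict Implicit.
Unset Printing Implicit Defensive.

Import Order.TTheory GRing.Theory Num.Theory.
Import numFieldNormedType.Exports.

Local Open Scope classical_set_scope.
Local Open Scope ring_scope.

(* A function on [t0, t1] is represented by a total function on R; every
   notion below depends only on its values on [t0, t1]. *)

Definition dotv (R : realType) (n : nat) (u v : 'rV[R]_n) : R :=
  \sum_(i < n) u 0 i * v 0 i.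

(* The library norm on 'rV[R]_n is the max norm (with the same topology). *)
Definition enorm (R : realType) (n : nat) (u : 'rV[R]_n) : R :=
  Num.sqrt (dotv u u).

Definition Gamma (R : realType) (a : R) : R :=
  \int[lebesgue_measure]_(s in `]0%R, +oo[) (s `^ (a - 1) * expR (- s)).

Definition frac_int (R : realType) (n : nat) (a t0 : R) (phi : R -> 'rV[R]_n)
    (t : R) : 'rV[R]_n :=
  \row_(i < n) ((Gamma a)^-1 *
    \int[lebesgue_measure]_(s in `[t0, t]) ((t - s) `^ (a - 1) * phi s 0 i)).

(* The derivative relative to [t0, t1], hence one-sided at t0 and t1; the value
   is arbitrary where it does not exist. *)
Definition derive_in (R : realType) (n : nat) (t0 t1 : R) (g : R -> 'rV[R]_n)
    (t : R) : 'rV[R]_n :=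
  lim ((s - t)^-1 *: (g s - g t) @[s --> within `[t0, t1] t^']).

Definition caputo (R : realType) (n : nat) (a t0 t1 : R) (phi : R -> 'rV[R]_n)
    : R -> 'rV[R]_n :=
  if a == 1 then derive_in t0 t1 phi
  else derive_in t0 t1 (frac_int (1 - a) t0 (fun s => phi s - phi t0)).

Definition cont_at_in (R : realType) (n : nat) (t0 t1 : R)
    (f : R -> 'rV[R]_n) (t : R) : Prop :=
  f s @[s --> within `[t0, t1] (nbhs t)] --> f t.

Definition PC (R : realType) (n : nat) (t0 t1 : R) (f : R -> 'rV[R]_n) : Prop :=
  exists D : seq R,
    [/\ forall t, t \in D -> t0 < t < t1,
        forall t, t0 <= t <= t1 -> t \notin D -> cont_at_in t0 t1 f t &
        forall t, t \in D -> cvg (f s @[s --> t^'-]) /\ cvg (f s @[s --> t^'+])].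

Definition PCalpha (R : realType) (n : nat) (a t0 t1 : R)
    (phi : R -> 'rV[R]_n) : Prop :=
  {within `[t0, t1], continuous phi} /\
  exists2 psi : R -> 'rV[R]_n, PC t0 t1 psi &
    forall t, t0 <= t <= t1 -> phi t = phi t0 + frac_int a t0 psi t.

Definition norm_C (R : realType) (n : nat) (t0 t1 : R) (y : R -> 'rV[R]_n) : R :=
  sup [set enorm (y t) | t in `[t0, t1]].

(* Truncation by 0 outside [t0, t1] restricts the essential supremum of the
   (nonnegative) norm to that interval. *)
Definition norm_Linfty (R : realType) (n : nat) (t0 t1 : R)
    (z : R -> 'rV[R]_n) : \bar R :=
  ess_sup lebesgue_measure ((fun t => (enorm (z t))%:E) \_ `[t0, t1]).

Definition norm_PCalpha (R : realType) (n : nat) (a t0 t1 : R)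
    (y : R -> 'rV[R]_n) : \bar R :=
  ((norm_C t0 t1 y)%:E + norm_Linfty t0 t1 (caputo a t0 t1 y))%E.

Definition functionalJ (R : realType) (n : nat) (a b t0 t1 : R)
    (L : R -> 'rV[R]_n -> 'rV[R]_n -> R) (x : R -> 'rV[R]_n) : R :=
  \int[lebesgue_measure]_(t in `[t0, t1])
    ((t1 - t) `^ (b - 1) * L t (x t) (caputo a t0 t1 x t)).

Definition admissible (R : realType) (n : nat) (a t0 t1 : R)
    (xa xb : 'rV[R]_n) (x : R -> 'rV[R]_n) : Prop :=
  [/\ PCalpha a t0 t1 x, x t0 = xa & x t1 = xb].

Definition weak_local_min (R : realType) (n : nat) (a b t0 t1 : R)
    (xa xb : 'rV[R]_n) (L : R -> 'rV[R]_n -> 'rV[R]_n -> R)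
    (x0 : R -> 'rV[R]_n) : Prop :=
  admissible a t0 t1 xa xb x0 /\
  exists2 delta : R, 0 < delta &
    forall x : R -> 'rV[R]_n, admissible a t0 t1 xa xb x ->
      (norm_PCalpha a t0 t1 (fun t => x t - x0 t)%R < delta%:E)%E ->
      functionalJ a b t0 t1 L x0 <= functionalJ a b t0 t1 L x.

(* The arbitrary values of [caputo] at jump points never create a spurious
   continuity point, since the one-sided limits differ there. *)
Definition cont_points (R : realType) (n : nat) (a t0 t1 : R)
    (x : R -> 'rV[R]_n) : set R :=
  [set t | t0 <= t <= t1 /\ cont_at_in t0 t1 (caputo a t0 t1 x) t].

Definition graph (R : realType) (n : nat) (a t0 t1 : R) (x : R -> 'rV[R]_n)
    : set (R * 'rV[R]_n * 'rV[R]_n) :=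
  [set p | exists t v, p = (t, x t, v) /\
     ((cont_points a t0 t1 x t /\ v = caputo a t0 t1 x t) \/
      [/\ t0 <= t <= t1, ~ cont_points a t0 t1 x t &
          caputo a t0 t1 x s @[s --> t^'-] --> v \/
          caputo a t0 t1 x s @[s --> t^'+] --> v])].

Definition grad (R : realType) (n : nat) (f : 'rV[R]_n -> R) (y : 'rV[R]_n)
    : 'rV[R]_n :=
  \row_(i < n) 'D_(delta_mx 0 i) f y.

Definition hessian (R : realType) (n : nat) (f : 'rV[R]_n -> R) (y : 'rV[R]_n)
    : 'M[R]_n :=
  \matrix_(i < n, j < n) 'D_(delta_mx 0 j) ('D_(delta_mx 0 i) f) y.

Definition twice_differentiable (R : realType) (n : nat) (f : 'rV[R]_n -> R)
    (y : 'rV[R]_n) : Prop :=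
  (\forall z \near y, differentiable f z) /\ differentiable (grad f) y.

Definition C1_near (R : realType) (n : nat)
    (L : R -> 'rV[R]_n -> 'rV[R]_n -> R)
    (G : set (R * 'rV[R]_n * 'rV[R]_n)) : Prop :=
  exists U : set (R * 'rV[R]_n * 'rV[R]_n), [/\ open U, G `<=` U &
    forall p, U p ->
      [/\ differentiable (fun x => L p.1.1 x p.2) p.1.2,
          differentiable (L p.1.1 p.1.2) p.2,
          {for p, continuous (fun q => L q.1.1 q.1.2 q.2)},
          {for p, continuous (fun q => grad (fun x => L q.1.1 x q.2) q.1.2)} &
          {for p, continuous (fun q => grad (L q.1.1 q.1.2) q.2)}]].

(* Main.v *)
(* Near a continuity point t of y = D^alpha x0, perturb x0 by I^alpha v, where v
   vanishes outside a small interval and alternates there, on a fine mesh, between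
   plus and minus (t1 - s)^(1 - alpha) xi, normalized to have size about |xi|.
   With that weight the kernel (t - s)^(alpha - 1) is nondecreasing in s, and it
   is constant for t = t1: so I^alpha v is an alternating sum of increasing terms,
   it tends to 0 uniformly as the mesh is refined, and it vanishes at t1, while v
   keeps its size.  The variation of J is then, to leading order, a positive
   multiple of L(t, x0, y + xi) + L(t, x0, y - xi) - 2 L(t, x0, y), which is
   therefore nonnegative for all small xi; continuity extends this to every
   continuity point, and the second-order expansion in xi concludes. *)
Require Import Defs.
From HB Require Import structures.
From mathcomp Require Import all_boot all_order all_algebra.
From mathcomp Require Import all_classical all_reals all_analysis.
From mathcomp Require Import ess_sup_inf measurable_realfun.
From mathcomp Require Import ring lra.

Set Implicit Arguments.
Unset Strict Implicit.
Unset Printing Implicit Defensive.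

Import Order.TTheory GRing.Theory Num.Theory.
Import numFieldNormedType.Exports.

Local Open Scope classical_set_scope.
Local Open Scope ring_scope.

(** The amplitude of the wave stays fixed while the mesh goes to 0, so the order of the choices
    matters. A negative second difference at t fixes an interval [p, q[ and with it a gain
    proportional to q - p. But I^alpha v need not vanish to the right of q: the state is perturbed
    up to t1, across the jumps of the derivative and where, for beta < 1, the weight (t1 - s)^(beta
    - 1) is unbounded. The loss is therefore bounded by eps times this integrable weight, with eps
    chosen after [p, q[; a tube around the whole graph then dictates how small I^alpha v must be,
    and only then is the mesh chosen. The weak norm sees v itself, which refinement does not reduce;
    this is what limits xi. The identity that restores the end condition, that the unweighted wave
    has integral 0, also removes the odd part of the increments for +xi and -xi, and the second
    difference is what remains. *)

Section affine_change.
Variable R : realType.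
Local Notation mu := (@lebesgue_measure R).

Let affine (c d : R) : measurableTypeR R -> measurableTypeR R :=
  fun x => c * x + d.

Let measurable_affine (c d : R) : measurable_fun [set: _] (affine c d).
Proof.
exact: measurable_realfun.measurable_funD.
Qed.

Let affine_measure (c d : R) : {measure set (measurableTypeR R) -> \bar R} :=
  mscale (NngNum (normr_ge0 c))
    (measure_function_pushforward__canonical__measure_function_Measure mu
      (measurable_affine c d)).

(** The scaled pushforward of the measure agrees with it on the intervals []a, b]], and uniqueness
    of the Lebesgue measure does the rest. A negative [c], which turns []a, b]] into an interval
    closed on the left, is wanted for the reflection s -> t - s. *)
Lemma lebesgue_measure_affine (c d : R) (A : set R) : c != 0 -> measurable A ->
  mu A = (`|c|%:E * mu ((fun x => (c * x + d)%R) @^-1` A))%E.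
Proof.
move=> c0 mA.
rewrite -[RHS]/(affine_measure c d A); apply: lebesgue_measure_unique => //.
move=> _ [[a b] _ <-] /=; rewrite /mscale/= /affine.
have [c_gt0|c_lt0|c_eq0] := ltrgt0P c; last by rewrite c_eq0 eqxx in c0.
- have E : (fun x => c * x + d) @^-1` [set` `]a, b]] =
      [set` `](a - d) / c, (b - d) / c]].
    apply/seteqP; split=> x /=; rewrite !in_itv/= ltr_pdivrMr// ler_pdivlMr//;
      by rewrite ltrBlDr lerBrDr [x * c]mulrC.
  rewrite [pushforward _ _ _](congr1 mu E).
  rewrite !lebesgue_measure_itv/= !lte_fin ltr_pM2r ?invr_gt0// ltrD2r.
  case: ifP => _; last by rewrite mule0.
  by rewrite -!EFinB -EFinM; congr EFin; field.
- have E : (fun x => c * x + d) @^-1` [set` `]a, b]] =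
      [set` `[(b - d) / c, (a - d) / c[].
    apply/seteqP; split=> x /=; rewrite !in_itv/= ltr_ndivlMr// ler_ndivrMr//;
      by rewrite ltrBlDr lerBrDr [x * c]mulrC andbC.
  rewrite [pushforward _ _ _](congr1 mu E).
  rewrite !lebesgue_measure_itv/= !lte_fin ltr_nM2r ?invr_lt0// ltrD2r.
  case: ifP => _; last by rewrite mule0.
  by rewrite -!EFinB -EFinM; congr EFin; field.
Qed.

Lemma ge0_integral_affine (c d : R) (D : set (measurableTypeR R))
    (f : measurableTypeR R -> \bar R) : c != 0 ->
  measurable D -> measurable_fun D f -> (forall x, D x -> (0 <= f x)%E) ->
  (\int[mu]_(y in D) f y =
   `|c|%:E * \int[mu]_(x in (fun x => (c * x + d)%R) @^-1` D) f (c * x + d)%R)%E.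
Proof.
move=> c0 mD mf f0.
transitivity (\int[affine_measure c d]_(y in D) f y)%E.
  by apply: eq_measure_integral => A mA _; exact: lebesgue_measure_affine.
rewrite ge0_integral_mscale//; congr (_ * _)%E.
rewrite (ge0_integral_pushforward (measurable_affine c d))// => y.
by rewrite inE; exact: f0.
Qed.

End affine_change.

(** * Integrals of powers and the Beta function *)

Section power_integral.
Variable R : realType.
Local Notation mu := (@lebesgue_measure R).

Lemma measurable_fun_powR_affine (c d p : R) (D : set R) :
  measurable D -> measurable_fun D (fun s : R => (c * s + d) `^ p).
Proof.
move=> mD; apply: measurable_funTS.
apply: (@measurableT_comp _ _ _ _ _ _ (fun y : R => y `^ p)).
  exact: measurable_powR.
by apply: measurable_realfun.measurable_funD.
Qed.

Lemma measurable_fun_powRB (t p : R) (D : set R) :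
  measurable D -> measurable_fun D (fun s : R => (t - s) `^ p).
Proof.
move=> mD; have := @measurable_fun_powR_affine (-1) t p D mD.
by under eq_fun do rewrite mulN1r addrC.
Qed.

Lemma integral_powR_gt0 (g a b : R) : g != 0 -> 0 < a -> a <= b ->
  (\int[mu]_(u in `[a, b]) (u `^ (g - 1))%:E = ((b `^ g - a `^ g) / g)%:E)%E.
Proof.
move=> g0 a0; rewrite le_eqVlt => /predU1P[<-|ab].
  by rewrite set_itv1 integral_set1 subrr mul0r.
have der p x : 0 < x -> derivable (fun y : R => y `^ p) x 1.
  by move=> x0; apply: derivable_powR; rewrite in_itv/= andbT.
have derF x : 0 < x -> derivable (fun u : R => u `^ g / g) x 1.
  by move=> x0; apply: derivableM => //; exact: der.
have cF x : 0 < x -> {for x, continuous (fun u : R => u `^ g / g)}.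
  by move=> x0; exact/differentiable_continuous/derivable1_diffP/derF.
rewrite (@continuous_FTC2 _ _ (fun u => u `^ g / g))//.
- by rewrite -EFinB mulrBl.
- apply: derivable_within_continuous => x; rewrite in_itv/= => /andP[ax _].
  by apply: der; exact: lt_le_trans ax.
- split.
  + by move=> x; rewrite in_itv/= => /andP[ax _]; apply/derF/(lt_trans a0).
  + by apply: cvg_at_right_filter; exact: cF.
  + by apply: cvg_at_left_filter; apply: cF; exact: lt_trans ab.
- move=> x; rewrite in_itv/= => /andP[ax _].
  have x0 : 0 < x by exact: lt_trans ax.
  rewrite derive1Mr; last exact: der.
  by rewrite powR_derive1 ?in_itv/= ?andbT// mulrAC divff// mul1r.
Qed.

(** For g < 1 the integrand is unbounded at 0 and the fundamental theorem stops short of a = 0; that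
    case follows by monotone convergence over the intervals [1 / (n + 1), b]. *)
Lemma integral_powR (g a b : R) : 0 < g -> 0 <= a -> a <= b ->
  (\int[mu]_(u in `[a, b]) (u `^ (g - 1))%:E = ((b `^ g - a `^ g) / g)%:E)%E.
Proof.
move=> g0; rewrite le_eqVlt => /predU1P[<-|a0] ab; last first.
  by rewrite integral_powR_gt0// gt_eqF.
rewrite powR0 ?gt_eqF// subr0.
have mf (D : set R) : measurable D ->
    measurable_fun D (fun u : R => (u `^ (g - 1))%:E).
  by move=> mD; apply/measurable_EFinP/measurable_funTS; exact: measurable_powR.
rewrite -integral_itv_obnd_cbnd; last exact: mf.
rewrite itv_open_bnd_bigcup.
pose F (n : nat) := [set` `[(0 + n.+1%:R^-1 : R), b]].
have FF : {homo F : n m / (n <= m)%N >-> (n <= m)%O}.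
  move=> n m nm; apply/subsetPset => x; rewrite /F/= !in_itv/= => /andP[nx ->].
  rewrite andbT (le_trans _ nx)// !add0r lef_pV2 ?posrE//.
  by rewrite ler_nat.
have lim1 : (\int[mu]_(x in F i) (x `^ (g - 1))%:E)%E @[i --> \oo] -->
    (\int[mu]_(x in \bigcup_i F i) (x `^ (g - 1))%:E)%E.
  apply: ge0_nondecreasing_set_cvg_integral => //.
  - by move=> i; exact: measurable_itv.
  - by move=> i; apply: mf; exact: measurable_itv.
  - by move=> i x _; rewrite lee_fin powR_ge0.
rewrite -(cvg_lim _ lim1)//; apply/cvg_lim => //.
have [b0|b0] := ltP 0 b; last first.
  have -> : b = 0 by apply/eqP; rewrite eq_le b0.
  rewrite powR0 ?gt_eqF// mul0r.
  rewrite (_ : (fun _ => _) = cst 0%E); first exact: cvg_cst.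
  apply/funext => i; rewrite /F set_itv_ge ?integral_set0//.
  by rewrite bnd_simp -ltNge add0r (le_lt_trans b0)// invr_gt0.
have : ((b `^ g - (n.+1%:R^-1 : R) `^ g) / g)%:E @[n --> \oo] -->
    ((b `^ g - 0) / g)%:E.
  apply: cvg_EFin; first exact: nearW.
  apply: cvgM; last exact: cvg_cst.
  apply: cvgB; first exact: cvg_cst.
  apply: (cvg_comp (fun n : nat => n.+1%:R^-1 : R) (fun x => x `^ g)); last first.
    exact: powR_cvg0.
  have h := @cvg_harmonic R.
  move=> A [e/= e0 eA]; near=> n.
  apply: eA => /=; last by rewrite invr_gt0.
  rewrite sub0r normrN.
  near: n. by move/cvgr0Pnorm_lt : h => /(_ _ e0).
rewrite subr0; apply: cvg_trans; apply: near_eq_cvg; near=> n.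
rewrite /F add0r integral_powR_gt0 ?gt_eqF ?invr_gt0//.
near: n; have := @cvg_harmonic R => /cvgr0Pnorm_lt/(_ _ b0).
apply: filterS => n; rewrite /harmonic/= => H; apply/ltW.
by rewrite -(ger0_norm (x := _^-1))// invr_ge0.
Unshelve. all: by end_near. Qed.

Lemma integral_powRB (g c d t : R) : 0 < g -> c <= d -> d <= t ->
  (\int[mu]_(s in `[c, d]) ((t - s) `^ (g - 1))%:E =
   (((t - c) `^ g - (t - d) `^ g) / g)%:E)%E.
Proof.
move=> g0 cd dt.
have td0 : 0 <= t - d by rewrite subr_ge0.
have tdc : t - d <= t - c by rewrite lerB.
have <- := integral_powR g0 td0 tdc.
rewrite [RHS](@ge0_integral_affine R (-1) t)//; last 2 first.
- by apply/measurable_EFinP/measurable_funTS; exact: measurable_powR.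
- by move=> x _; rewrite lee_fin powR_ge0.
rewrite normrN1 mul1e.
have -> : (fun x => -1 * x + t) @^-1` [set` `[t - d, t - c]] = [set` `[c, d]].
  by apply/seteqP; split=> x /=; rewrite !in_itv/= mulN1r; lra.
by apply: eq_integral => x _; rewrite mulN1r addrC.
Qed.

End power_integral.

Section gamma_beta.
Variable R : realType.
Local Notation mu := (@lebesgue_measure R).

Lemma powR_le0_anti (p x y : R) : p <= 0 -> 0 < x -> x <= y ->
  y `^ p <= x `^ p.
Proof.
move=> p0 x0 xy; have y0 : 0 < y by exact: lt_le_trans xy.
rewrite -[p]opprK !(powRN _ (- p)) lef_pV2 ?posrE ?powR_gt0//.
by apply: ge0_ler_powR; rewrite ?nnegrE ?oppr_ge0// ltW.
Qed.

Lemma powR_le0_ge1 (p x : R) : p <= 0 -> 0 < x -> x <= 1 -> 1 <= x `^ p.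
Proof.
by move=> p0 x0 x1; have := powR_le0_anti p0 x0 x1; rewrite powR1.
Qed.

Lemma powR_le0_le1 (p x : R) : p <= 0 -> 1 <= x -> x `^ p <= 1.
Proof.
by move=> p0 x1; have := powR_le0_anti p0 ltr01 x1; rewrite powR1.
Qed.

(** [Gamma] is the [fine] part of an extended integral, so its positivity requires finiteness too.
    On ]0, 1] the integrand lies between 1 / e and s^(a - 1); beyond 1 it is at most the exponential
    density. *)
Lemma Gamma_gt0 (a : R) : 0 < a <= 1 -> 0 < Gamma a.
Proof.
move=> /andP[a0 a1]; rewrite /Gamma /Rintegral; apply: fine_gt0.
pose f (s : R) := s `^ (a - 1) * expR (- s).
have mf (D : set R) : measurable D -> measurable_fun D (EFin \o f).
  move=> mD; apply/measurable_EFinP/measurable_funTS.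
  apply: measurable_realfun.measurable_funM; first exact: measurable_powR.
  apply: continuous_measurable_fun => x.
  apply: (@continuous_comp _ _ _ -%R expR); last exact: continuous_expR.
  exact: oppr_continuous.
have f0 s : 0 <= f s by rewrite /f mulr_ge0 ?powR_ge0 ?expR_ge0.
have -> : [set` `]0, +oo[] = [set` `]0, 1]] `|` [set` `]1, +oo[] :> set R.
  apply/seteqP; split=> x /=; rewrite !in_itv/= !andbT; first by lra.
  by case=> [/andP[->//]|]; lra.
rewrite ge0_integral_setU//=; last 3 first.
- by apply: mf; exact: measurableU.
- by move=> x _; rewrite lee_fin f0.
- rewrite disj_set2E; apply/eqP/seteqP; split=> // x /=.
  by rewrite !in_itv/= => -[]; lra.
have le1 : ((expR (-1))%:E <= \int[mu]_(x in `]0%R, 1%R]) (f x)%:E)%E.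
  have -> : (expR (-1))%:E = (\int[mu]_(x in `]0%R, 1%R]) (expR (-1))%:E)%E.
    rewrite integral_cst//= lebesgue_measure_itv/= lte_fin ltr01.
    by rewrite sube0 mule1.
  apply: ge0_le_integral => //.
  - exact: mf.
  - move=> x /=; rewrite in_itv/= => /andP[x0 x1]; rewrite lee_fin /f.
    rewrite -[leLHS]mul1r ler_pM ?expR_ge0//.
    + by apply: powR_le0_ge1 => //; rewrite subr_le0.
    + by rewrite ler_expR lerN2.
have up1 : (\int[mu]_(x in `]0%R, 1%R]) (f x)%:E <= (a^-1)%:E)%E.
  have -> : (a^-1)%:E = (\int[mu]_(x in `]0%R, 1%R]) (x `^ (a - 1))%:E)%E.
    rewrite integral_itv_obnd_cbnd; last first.
      by apply/measurable_EFinP/measurable_funTS; exact: measurable_powR.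
    by rewrite integral_powR// powR1 powR0 ?gt_eqF// subr0 mul1r.
  apply: ge0_le_integral => //.
  - by move=> x _; rewrite lee_fin.
  - exact: mf.
  - by apply/measurable_EFinP/measurable_funTS; exact: measurable_powR.
  - move=> x /=; rewrite in_itv/= => /andP[x0 x1]; rewrite lee_fin /f.
    by rewrite ler_piMr ?powR_ge0// -expR0 ler_expR oppr_le0 ltW.
have up2 : (\int[mu]_(x in `]1%R, +oo[) (f x)%:E <= 1)%E.
  rewrite -(integral_exponential_pdf (@ltr01 R)).
  have mpdf : measurable_fun setT (fun x : R => (exponential_pdf 1 x)%:E).
    by apply/measurable_EFinP; exact: measurable_exponential_pdf.
  apply: (@le_trans _ _ (\int[mu]_(x in `]1%R, +oo[) (exponential_pdf 1 x)%:E)%E).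
    apply: ge0_le_integral => //.
    + by move=> x _; rewrite lee_fin.
    + exact: mf.
    + exact: measurable_funTS.
    + move=> x /=; rewrite in_itv/= andbT => x1.
      rewrite lee_fin exponential_pdfE; last by lra.
      rewrite /f mul1r mulN1r ler_piMl ?expR_ge0//.
      by apply: powR_le0_le1; lra.
  apply: ge0_subset_integral => //.
  by move=> x _; rewrite lee_fin exponential_pdf_ge0.
apply/andP; split.
  apply: (@lt_le_trans _ _ (expR (-1))%:E); first by rewrite lte_fin expR_gt0.
  apply: (le_trans le1); rewrite leeDl// integral_ge0// => x _.
  exact: f0.
apply: (@le_lt_trans _ _ ((a^-1)%:E + 1)%E); first exact: leeD.
by rewrite -EFinD ltry.
Qed.

(** Euler's integral B(a, 1 - a). The exponent stays in the form [1 - a - 1] to match the kernel of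
    order 1 - a. *)
Definition beta_integral (a : R) : \bar R :=
  (\int[mu]_(u in `]0%R, 1%R[) ((1 - u) `^ (1 - a - 1) * u `^ (a - 1))%:E)%E.

Lemma measurable_beta_kernel (a s t : R) (D : set R) : measurable D ->
  measurable_fun D
    (fun r : R => ((t - r) `^ (1 - a - 1) * (r - s) `^ (a - 1))%:E).
Proof.
move=> mD; apply/measurable_EFinP/measurable_realfun.measurable_funM.
  exact: measurable_fun_powRB.
have := @measurable_fun_powR_affine R 1 (- s) (a - 1) D mD.
by under eq_fun do rewrite mul1r.
Qed.

(** Both exponents lie between -1 and 0, so both factors are at least 1. Left of 1/2 the factor in 1
    - u is at most 2, right of it the factor in u is, so the kernel is below a sum of two integrable
    powers. *)
Lemma beta_integral_gt0 (a : R) : 0 < a < 1 -> (0 < beta_integral a < +oo)%E.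
Proof.
move=> /andP[a0 a1]; rewrite /beta_integral.
have mk (D : set R) : measurable D -> measurable_fun D
    (fun u : R => ((1 - u) `^ (1 - a - 1) * u `^ (a - 1))%:E).
  move=> mD; have := @measurable_beta_kernel a 0 1 D mD.
  by under eq_fun do rewrite subr0.
apply/andP; split.
  apply: (@lt_le_trans _ _ 1%E) => //.
  have -> : 1%E = (\int[mu]_(x in `]0%R, 1%R[) (1%R : R)%:E)%E.
    rewrite integral_cst//= lebesgue_measure_itv/= lte_fin ltr01.
    by rewrite sube0 mule1.
  apply: ge0_le_integral => //; first exact: mk.
  move=> u /=; rewrite in_itv/= => /andP[u0 u1]; rewrite lee_fin.
  rewrite -[leLHS]mulr1 ler_pM//.
    by apply: powR_le0_ge1; lra.
  by apply: powR_le0_ge1; lra.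
apply: (@le_lt_trans _ _ (\int[mu]_(u in `[0%R, 1%R])
    ((2 * u `^ (a - 1))%:E + (2 * (1 - u) `^ (1 - a - 1))%:E))%E); last first.
  rewrite ge0_integralD//=; last 4 first.
  - by move=> u _; rewrite lee_fin mulr_ge0 ?powR_ge0.
  - apply/measurable_EFinP/measurable_realfun.measurable_funM => //.
    by apply: measurable_funTS; exact: measurable_powR.
  - by move=> u _; rewrite lee_fin mulr_ge0 ?powR_ge0.
  - apply/measurable_EFinP/measurable_realfun.measurable_funM => //.
    exact: measurable_fun_powRB.
  under eq_integral do rewrite EFinM.
  under [X in (_ + X)%E]eq_integral do rewrite EFinM.
  rewrite !ge0_integralZl//=; last 4 first.
  - by apply/measurable_EFinP; exact: measurable_fun_powRB.
  - by move=> u _; rewrite lee_fin powR_ge0.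
  - by apply/measurable_EFinP/measurable_funTS; exact: measurable_powR.
  - by move=> u _; rewrite lee_fin powR_ge0.
  rewrite integral_powR// integral_powRB//; last by rewrite subr_gt0.
  by rewrite -!EFinM -EFinD ltry.
apply: (@le_trans _ _ (\int[mu]_(u in `]0%R, 1%R[)
    ((2 * u `^ (a - 1))%:E + (2 * (1 - u) `^ (1 - a - 1))%:E))%E); last first.
  apply: ge0_subset_integral => //.
  - apply: emeasurable_funD; apply/measurable_EFinP/measurable_realfun.measurable_funM => //.
    + by apply: measurable_funTS; exact: measurable_powR.
    + exact: measurable_fun_powRB.
  - by move=> u _; rewrite -EFinD lee_fin addr_ge0 ?mulr_ge0 ?powR_ge0.
  - by apply: subset_itv; rewrite bnd_simp.
apply: ge0_le_integral => //.
- by move=> u _; rewrite lee_fin mulr_ge0 ?powR_ge0.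
- exact: mk.
- apply: emeasurable_funD; apply/measurable_EFinP/measurable_realfun.measurable_funM => //.
  + by apply: measurable_funTS; exact: measurable_powR.
  + exact: measurable_fun_powRB.
move=> u /=; rewrite in_itv/= => /andP[u0 u1]; rewrite -EFinD lee_fin.
have half (p : R) : -1 <= p -> p <= 0 -> (2^-1 : R) `^ p <= 2.
  move=> p1 p0; rewrite -powR_inv1// -powRrM mulN1r -[leRHS]powRr1//.
  by apply: ler_powR; lra.
have [u2|u2] := leP u 2^-1.
- rewrite -[leLHS]addr0 lerD ?mulr_ge0 ?powR_ge0// ler_wpM2r ?powR_ge0//.
  apply: le_trans (half (1 - a - 1) _ _); [|lra|lra].
  by apply: powR_le0_anti; lra.
- rewrite mulrC -[leLHS]add0r lerD ?mulr_ge0 ?powR_ge0// ler_wpM2r ?powR_ge0//.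
  apply: le_trans (half (a - 1) _ _); [|lra|lra].
  by apply: powR_le0_anti; lra.
Qed.

(** Under r = s + (t - s) u the two powers produce (t - s)^(-1), which cancels the Jacobian: the
    value depends neither on s nor on t. This is what makes the orders a and 1 - a compose to plain
    integration. *)
Lemma integral_beta_kernel (a s t : R) : s < t ->
  (\int[mu]_(r in `]s, t[) ((t - r) `^ (1 - a - 1) * (r - s) `^ (a - 1))%:E =
   beta_integral a)%E.
Proof.
move=> st; have ts0 : 0 < t - s by rewrite subr_gt0.
rewrite (@ge0_integral_affine R (t - s) s)//; last 3 first.
- by rewrite gt_eqF.
- exact: measurable_beta_kernel.
- by move=> x _; rewrite lee_fin mulr_ge0 ?powR_ge0.
have -> : (fun x => (t - s) * x + s) @^-1` [set` `]s, t[] = [set` `]0, 1[].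
  apply/seteqP; split=> x /=; rewrite !in_itv/= => /andP[x0 x1].
    by apply/andP; split; [rewrite -(pmulr_rgt0 _ ts0)|
      rewrite -(ltr_pM2l ts0) mulr1]; lra.
  by apply/andP; split; [rewrite ltrDr mulr_gt0|
    rewrite -ltrBrDr gtr_pMr].
rewrite /beta_integral -ge0_integralZl//=; last 2 first.
- apply/measurable_EFinP/measurable_realfun.measurable_funM.
    apply: (eq_measurable_fun
        (fun x : R => (- (t - s) * x + (t - s)) `^ (1 - a - 1))).
      by move=> x _; congr (_ `^ _); ring.
    exact: measurable_fun_powR_affine.
  apply: (eq_measurable_fun (fun x : R => ((t - s) * x + 0) `^ (a - 1))).
    by move=> x _; congr (_ `^ _); ring.
  exact: measurable_fun_powR_affine.
- by move=> x _; rewrite lee_fin mulr_ge0 ?powR_ge0.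
apply: eq_integral => u; rewrite inE/= in_itv/= => /andP[u0 u1].
rewrite -EFinM; congr EFin.
rewrite addrK (_ : t - ((t - s) * u + s) = (t - s) * (1 - u)); last by ring.
rewrite !powRM ?(ltW ts0) ?subr_ge0 ?(ltW u0) ?(ltW u1)//.
rewrite gtr0_norm// mulrACA mulrA -powRD; last by rewrite (gt_eqF ts0) implybT.
rewrite (_ : 1 - a - 1 + (a - 1) = -1); last by ring.
by rewrite powR_inv1 ?ltW// !mulrA divff ?mul1r// gt_eqF.
Qed.

End gamma_beta.

Section real_integrable.
Context d (T : measurableType d) (R : realType) (mu : {measure set T -> \bar R}).
Implicit Types (A : set T) (f g : T -> R).

Lemma integrableRD A f g : measurable A -> mu.-integrable A (EFin \o f) ->
  mu.-integrable A (EFin \o g) -> mu.-integrable A (EFin \o (fun s => f s + g s)).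
Proof. by move=> mA fi gi; have := integrableD mA fi gi. Qed.

Lemma integrableRB A f g : measurable A -> mu.-integrable A (EFin \o f) ->
  mu.-integrable A (EFin \o g) -> mu.-integrable A (EFin \o (fun s => f s - g s)).
Proof. by move=> mA fi gi; have := integrableB mA fi gi. Qed.

Lemma integrableRZ A k f : measurable A -> mu.-integrable A (EFin \o f) ->
  mu.-integrable A (EFin \o (fun s => k * f s)).
Proof. by move=> mA fi; have := integrableZl mA k fi. Qed.

End real_integrable.

(** * Integrals against the kernel (t - s)^(g - 1) and the semigroup law *)

Section kernel_integral.
Variable R : realType.
Local Notation mu := (@lebesgue_measure R).

Definition bounded_measurable (c d : R) (f : R -> R) : Prop :=
  measurable_fun `[c, d] f /\ exists M, forall s, c <= s <= d -> `|f s| <= M.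

Lemma bounded_measurable_subset (c d c' d' : R) (f : R -> R) :
  c <= c' -> d' <= d -> bounded_measurable c d f -> bounded_measurable c' d' f.
Proof.
move=> cc' dd' [mf [M fM]]; split.
  by apply: measurable_funS mf => //; apply: subset_itv; rewrite bnd_simp.
by exists M => s sc; apply: fM; lra.
Qed.

Lemma bounded_norm_le (A : set R) (f : R -> R) (M : R) :
  (forall s, A s -> `|f s| <= M) -> [bounded f x | x in A].
Proof.
move=> fM; exists M; split; first exact: num_real.
by move=> N MN s As /=; exact: le_trans (fM _ As) (ltW MN).
Qed.

Lemma integrable_bounded_measurable (c d : R) (f : R -> R) :
  bounded_measurable c d f -> mu.-integrable `[c, d] (EFin \o f).
Proof.
move=> [mf [M fM]]; apply: measurable_bounded_integrable => //.
  by rewrite /= lebesgue_measure_itv/=; case: ifP => _; rewrite -?EFinB ltry.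
by apply: (@bounded_norm_le _ _ M) => s /=; rewrite in_itv/=; exact: fM.
Qed.

Lemma integrable_powRB (g c d t : R) : 0 < g -> d <= t ->
  mu.-integrable `[c, d] (fun s : R => ((t - s) `^ (g - 1))%:E).
Proof.
move=> g0 dt; have [cd|dc] := leP c d; last first.
  rewrite set_itv_ge ?bnd_simp -?ltNge//; exact: integrable_set0.
apply/integrableP; split.
  by apply/measurable_EFinP; exact: measurable_fun_powRB.
under eq_integral do rewrite abse_EFin ger0_norm ?powR_ge0//.
by rewrite integral_powRB// ltry.
Qed.

Lemma integrable_kernel (g c d t : R) (f : R -> R) : 0 < g -> d <= t ->
  bounded_measurable c d f ->
  mu.-integrable `[c, d] (fun s : R => ((t - s) `^ (g - 1) * f s)%:E).
Proof.
move=> g0 dt [mf [M fM]].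
apply: (integrableMl _ (integrable_powRB c g0 dt)) => //.
by apply: (@bounded_norm_le _ _ M) => s /=; rewrite in_itv/=; exact: fM.
Qed.

Lemma Rintegral_powRB (g c d t : R) : 0 < g -> c <= d -> d <= t ->
  \int[mu]_(s in `[c, d]) ((t - s) `^ (g - 1)) =
  ((t - c) `^ g - (t - d) `^ g) / g.
Proof. by move=> g0 cd dt; rewrite /Rintegral integral_powRB. Qed.

Lemma kernel_integral_bound (g c d t M : R) (f : R -> R) :
  0 < g -> c <= d -> d <= t -> measurable_fun `[c, d] f ->
  (forall s, c <= s <= d -> `|f s| <= M) ->
  `|\int[mu]_(s in `[c, d]) ((t - s) `^ (g - 1) * f s)| <=
  M * (((t - c) `^ g - (t - d) `^ g) / g).
Proof.
move=> g0 cd dt mf fM.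
have ik : mu.-integrable `[c, d] (fun s : R => ((t - s) `^ (g - 1) * f s)%:E).
  by apply: integrable_kernel => //; split=> //; exists M.
apply: (le_trans (le_normr_Rintegral _ ik)) => //.
rewrite -Rintegral_powRB// -RintegralZl//; last exact: integrable_powRB.
apply: le_Rintegral => //.
- by apply/integrable_norm.
- by apply: integrableRZ => //; exact: integrable_powRB.
- move=> s /=; rewrite in_itv/= => sc.
  by rewrite normrM ger0_norm ?powR_ge0// mulrC ler_wpM2r ?powR_ge0// fM.
Qed.

(** Setting the power to 0 for u <= 0 turns the integrand over the triangle c <= s < r < t into a
    function on the whole plane, to which Fubini applies. *)
Let kpos (p : R) : R -> R := (fun u => u `^ p) \_ `]0, +oo[.

Let kpos_gt0 (p u : R) : 0 < u -> kpos p u = u `^ p.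
Proof. by move=> u0; rewrite /kpos patchE ifT// inE/= in_itv/= andbT. Qed.

Let kpos_le0 (p u : R) : u <= 0 -> kpos p u = 0.
Proof.
move=> u0; rewrite /kpos patchE ifF//; apply/negbTE.
by rewrite notin_setE/= in_itv/= andbT; apply/negP; rewrite -leNgt.
Qed.

Let measurable_kpos (p : R) : measurable_fun setT (kpos p).
Proof.
apply: (measurable_restrictT _ _).1 => //.
by apply: measurable_funTS; exact: measurable_powR.
Qed.

Lemma integral_patch (D : set R) (f : R -> R) :
  (\int[mu]_x ((f \_ D) x)%:E = \int[mu]_(x in D) (f x)%:E)%E.
Proof. by rewrite [RHS]integral_mkcond restrict_EFin. Qed.

(** Dirichlet's exchange of the order of integration over the triangle c <= s < r < t: for each
    fixed s the integral in r is the same Beta integral. *)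
Lemma fractional_semigroup (a c d t : R) (f : R -> R) : 0 < a < 1 ->
  c <= t <= d -> bounded_measurable c d f ->
  \int[mu]_(r in `[c, t]) ((t - r) `^ (1 - a - 1) *
     \int[mu]_(s in `[c, r]) ((r - s) `^ (a - 1) * f s)) =
  fine (beta_integral a) * \int[mu]_(s in `[c, t]) f s.
Proof.
move=> /andP[a0 a1] /andP[ct td] bf.
have /andP[B0 By] : (0 < beta_integral a < +oo)%E.
  by apply: beta_integral_gt0; rewrite a0.
have Bfin : beta_integral a \is a fin_num by rewrite ge0_fin_numE// ltW.
have bft : bounded_measurable c t f by exact: bounded_measurable_subset bf.
have ift := integrable_bounded_measurable bft.
pose ft : measurableTypeR R -> R := f \_ `[c, t].
have mft : measurable_fun setT ft.
  by apply: (measurable_restrictT _ _).1 => //; exact: bft.1.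
pose F (z : measurableTypeR R * measurableTypeR R) : R :=
  kpos (1 - a - 1) (t - z.1) * (kpos (a - 1) (z.1 - z.2) * ft z.2).
have mF : measurable_fun setT (EFin \o F).
  apply/measurable_EFinP/measurable_realfun.measurable_funM.
    apply: measurableT_comp; first exact: measurable_kpos.
    by apply: measurable_realfun.measurable_funB.
  apply: measurable_realfun.measurable_funM.
    apply: measurableT_comp; first exact: measurable_kpos.
    by apply: measurable_realfun.measurable_funB.
  by apply: measurableT_comp.
have ftE s : c <= s <= t -> ft s = f s.
  by move=> st; rewrite /ft patchE ifT// inE/= in_itv/=.
have ft0 s : ~~ (c <= s <= t) -> ft s = 0.
  by move=> st; rewrite /ft patchE ifF//; apply/negbTE; rewrite notin_setE/= in_itv/=; exact/negP.
have F0 r s : ~~ [&& c <= s, s < r & r < t] -> F (r, s) = 0.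
  rewrite /F/= !negb_and -!leNgt -ltNge => /or3P[sc|rs|tr].
  - by rewrite ft0 ?mulr0//; lra.
  - by rewrite (@kpos_le0 _ (r - s)) ?mul0r ?mulr0//; lra.
  - by rewrite kpos_le0 ?mul0r//; lra.
have FE r s : c <= s -> s < r -> r < t -> F (r, s) =
    (t - r) `^ (1 - a - 1) * ((r - s) `^ (a - 1) * f s).
  by move=> cs sr rt; rewrite /F/= !kpos_gt0 ?subr_gt0// ftE//; lra.
have inner2 r : (\int[mu]_s (F (r, s))%:E = ((fun r => (t - r) `^ (1 - a - 1) *
    \int[mu]_(s in `[c, r]) ((r - s) `^ (a - 1) * f s)) \_ `[c, t[ r)%:E)%E.
  rewrite patchE; case: ifPn => [|]; last first.
    rewrite notin_setE/= in_itv/= => /negP crt.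
    apply: integral0_eq => s _; rewrite F0//.
    by apply: contra crt => /and3P[cs sr ->]; rewrite andbT; lra.
  rewrite inE/= in_itv/= => /andP[cr rt].
  have bfr : bounded_measurable c r f.
    by apply: bounded_measurable_subset bft => //; exact: ltW.
  have ik := integrable_kernel a0 (lexx r) bfr.
  rewrite -RintegralZl// /Rintegral fineK; last first.
    apply: integrable_fin_num => //.
    exact: integrableRZ.
  have mG : measurable_fun `[c, r] (fun s => ((t - r) `^ (1 - a - 1) *
      ((r - s) `^ (a - 1) * f s))%:E).
    apply/measurable_EFinP/measurable_realfun.measurable_funM => //.
    by apply/measurable_EFinP; exact: measurable_int ik.
  rewrite -[RHS]integral_itv_bndo_bndc; last first.
    by apply: measurable_funS mG => //; apply: subset_itv; rewrite bnd_simp.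
  rewrite [RHS]integral_mkcond; apply: eq_integral => s _.
  rewrite patchE; case: ifPn => [|].
    by rewrite inE/= in_itv/= => /andP[cs sr]; rewrite FE.
  rewrite notin_setE/= in_itv/= => /negP csr; rewrite F0//.
  by apply: contra csr => /and3P[-> ->].
(* Stated for arbitrary [G] and [g] because it serves twice: with the modulus of F for integrability
   on the plane, and with F for the value. *)
have inner1 (G g : R -> R) s : (forall r, c <= s -> s < r -> r < t ->
      G r = (t - r) `^ (1 - a - 1) * ((r - s) `^ (a - 1) * g s)) ->
    (forall r, ~~ [&& c <= s, s < r & r < t] -> G r = 0) ->
    (\int[mu]_r (G r)%:E = beta_integral a * ((g \_ `[c, t[) s)%:E)%E.
  move=> GE G0; rewrite patchE; case: ifPn => [|]; last first.
    rewrite notin_setE/= in_itv/= => /negP cst.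
    rewrite mule0; apply: integral0_eq => r _; rewrite G0//.
    by apply: contra cst => /and3P[-> sr rt]/=; lra.
  rewrite inE/= in_itv/= => /andP[cs st].
  rewrite -(integral_beta_kernel a st) muleC -integralZl//; last first.
    apply/integrableP; split; first exact: measurable_beta_kernel.
    under eq_integral do rewrite abse_EFin ger0_norm ?mulr_ge0 ?powR_ge0//.
    by rewrite integral_beta_kernel.
  rewrite [RHS]integral_mkcond; apply: eq_integral => r _.
  rewrite patchE; case: ifPn => [|].
    rewrite inE/= in_itv/= => /andP[sr rt]; rewrite GE// -EFinM.
    by congr EFin; ring.
  rewrite notin_setE/= in_itv/= => /negP srt; rewrite G0//.
  by apply: contra srt => /and3P[_ -> ->].
have abs_inner1 s : (\int[mu]_r `|(EFin \o F) (r, s)| =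
    beta_integral a * (((fun s => `|f s|) \_ `[c, t[) s)%:E)%E.
  apply: (inner1 (fun r => `|F (r, s)|)) => [r cs sr rt|r rs].
    by rewrite FE// !normrM ger0_norm ?powR_ge0// ger0_norm ?powR_ge0.
  by rewrite F0// normr0.
have val_inner1 s : (\int[mu]_r (EFin \o F) (r, s) =
    beta_integral a * ((f \_ `[c, t[) s)%:E)%E.
  apply: (inner1 (fun r => F (r, s))) => [r cs sr rt|r rs]; first by rewrite FE.
  by rewrite F0.
have mfo : measurable_fun `[c, t[ f.
  by apply: measurable_funS bft.1 => //; apply: subset_itv; rewrite bnd_simp.
have ifo : mu.-integrable `[c, t[ (EFin \o f).
  by apply: integrableS ift => //; apply: subset_itv; rewrite bnd_simp.
have iF : (mu \x mu)%E.-integrable setT (EFin \o F).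
  apply/integrable21ltyP => //.
  under eq_integral do rewrite abs_inner1.
  rewrite ge0_integralZl//; last 3 first.
  - apply/measurable_EFinP/(measurable_restrictT _ _).1 => //.
    exact: measurableT_comp.
  - by move=> s _; rewrite lee_fin; apply: restrict_ge0 => x _; exact: normr_ge0.
  - exact: ltW.
  apply: lte_mul_pinfty => //; first exact: ltW.
  by rewrite integral_patch; move/integrableP : ifo => [].
pose h r := (t - r) `^ (1 - a - 1) *
  \int[mu]_(s in `[c, r]) ((r - s) `^ (a - 1) * f s).
(* Measurability of [h] is read off Fubini's theorem, since it is a partial integral of F on [c,
   t[. *)
have mh : measurable_fun `[c, t[ h.
  apply/measurable_restrictT => //; apply/measurable_EFinP.
  have := measurable_fubini_F iF.
  by apply: eq_measurable_fun => r _; exact: inner2.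
have := Fubini iF.
under eq_integral do rewrite inner2.
under [X in _ = X -> _]eq_integral do rewrite val_inner1.
rewrite -(fineK Bfin) integralZl//; last first.
  have : mu.-integrable setT ((EFin \o f) \_ `[c, t[).
    by apply/integrable_restrict => //; rewrite setTI.
  by rewrite restrict_EFin.
rewrite !integral_patch.
rewrite integral_itv_bndo_bndc; last exact/measurable_EFinP.
rewrite integral_itv_bndo_bndc; last exact/measurable_EFinP.
rewrite /Rintegral -fineM//; last exact: integrable_fin_num.
by move=> <-.
Qed.

End kernel_integral.

(** * Fractional integrals and Caputo derivatives *)

Section row_vectors.
Variables (R : realType) (n : nat).
Implicit Types u v : 'rV[R]_n.

Lemma rV_norm_le u (e : R) : 0 <= e -> (forall i, `|u 0 i| <= e) -> `|u| <= e.
Proof.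
move=> e0 ue; rewrite /Num.Def.normr/= mx_normrE (bigmax_le _ e0)//= => -[i j] _.
by rewrite (ord1 i).
Qed.

Lemma rV_coord_le u i : `|u 0 i| <= `|u|.
Proof.
by rewrite [leRHS]/Num.Def.normr/= mx_normrE; exact: (le_bigmax _ _ (0, i)).
Qed.

Lemma cvg_rV (T : Type) (F : set_system T) (f : T -> 'rV[R]_n) v : Filter F ->
  (forall i, f s 0 i @[s --> F] --> v 0 i) -> f s @[s --> F] --> v.
Proof.
move=> FF fv; apply/cvgrPdist_le => e e0.
have : \forall s \near F, forall i, `|v 0 i - f s 0 i| <= e.
  by apply: filter_forall => i; move/cvgrPdist_le : (fv i); exact.
apply: filterS => s H; apply: rV_norm_le; first exact: ltW.
by move=> i; rewrite !mxE.
Qed.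

Lemma cvg_coord (T : Type) (F : set_system T) (f : T -> 'rV[R]_n) v i :
  Filter F -> f s @[s --> F] --> v -> f s 0 i @[s --> F] --> v 0 i.
Proof.
move=> FF fv; apply: (cvg_comp f (fun u : 'rV[R]_n => u 0 i) fv).
exact: coord_continuous.
Qed.

Lemma dotv_ge0 u : 0 <= dotv u u.
Proof. by apply: sumr_ge0 => i _; rewrite -expr2 sqr_ge0. Qed.

(** A crude form of the factor sqrt n between the two norms; the factors n + 1 in the later choices
    of radii absorb it. *)
Lemma enorm_le u : enorm u <= n%:R * `|u|.
Proof.
rewrite -(@ler_pXn2r _ 2)// ?nnegrE ?sqrtr_ge0 ?mulr_ge0//.
rewrite sqr_sqrtr ?dotv_ge0// /dotv exprMn.
apply: (@le_trans _ _ (\sum_(i < n) `|u| ^+ 2)).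
  apply: ler_sum => i _; rewrite -expr2 -real_normK ?num_real//.
  by rewrite ler_pXn2r// ?nnegrE// rV_coord_le.
rewrite sumr_const card_ord -[_ *+ n]mulr_natl ler_wpM2r ?sqr_ge0//.
by rewrite -natrX ler_nat; case: (n) => // m; rewrite leq_pmulr.
Qed.

End row_vectors.

(** * Piecewise continuous functions: neighborhoods and measurability *)

Section piecewise_continuity.
Variable R : realType.
Implicit Types (D : seq R) (t : R).

Lemma near_split t (P : R -> Prop) : (\forall s \near t^'-, P s) -> P t ->
  (\forall s \near t^'+, P s) -> \forall s \near t, P s.
Proof.
rewrite !near_withinE => + Pt; apply: filterS2 => s Pl Pr.
by have [/Pl|/Pr|->] := ltgtP s t.
Qed.

Lemma near_notin_seq D t : \forall s \near t, s != t -> s \notin D.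
Proof.
elim: D => [|x D IH]; first by near=> s; rewrite in_nil.
have : \forall s \near t, s != t -> s != x.
  have [->|tx] := eqVneq x t; first by near=> s.
  have : \forall s \near t, s != x.
    apply: open_nbhs_nbhs; split; last by rewrite /= eq_sym.
    exact: (@open_neq _ x).
  by apply: filterS => s sx _.
move: IH; apply: filterS2 => s sD sx st.
by rewrite inE negb_or sx// sD.
Unshelve. all: by end_near. Qed.

Lemma near_notin D t : t \notin D -> \forall s \near t, s \notin D.
Proof.
move=> tD; have := near_notin_seq D t; apply: filterS => s.
by have [->//|_ ->] := eqVneq s t.
Qed.

Lemma measurable_seq D : measurable [set` D].
Proof.
apply: countable_measurable; first by move=> t; exact: measurable_set1.
by apply: finite_set_countable; exact: finite_seq.
Qed.

Lemma lebesgue_measure_seq D : lebesgue_measure [set` D] = 0%E :> \bar R.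
Proof.
by apply: countable_lebesgue_measure0; apply: finite_set_countable; exact: finite_seq.
Qed.

(** Off [D] the function is continuous on a measurable subspace; on the finite rest every preimage
    is countable, hence measurable. *)
Lemma measurable_fun_off_seq (c d : R) D (g : R -> R) :
  (forall t, c <= t <= d -> t \notin D -> g s @[s --> within `[c, d] (nbhs t)] --> g t) ->
  measurable_fun `[c, d] g.
Proof.
move=> gD; set A : set R := `[c, d] `\` [set` D].
have mA : measurable A by apply: measurableD => //; exact: measurable_seq.
have mAg : measurable_fun A g.
  apply: subspace_continuous_measurable_fun => //.
  apply/subspace_continuousP => t [tcd tD].
  have tD' : t \notin D by exact/negP.
  rewrite /= in_itv/= in tcd; apply: cvg_trans (gD t tcd tD').
  by apply: cvg_app; apply: within_subset => s [].
have mB : measurable (`[c, d] `&` [set` D] : set R).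
  by apply: measurableI => //; exact: measurable_seq.
have -> : [set` `[c, d]] = A `|` (`[c, d] `&` [set` D]).
  by rewrite /A setDE -setIUr setUC setUv setIT.
apply/measurable_funU => //; split=> // _ Y mY.
apply: countable_measurable; first by move=> t; exact: measurable_set1.
by apply: finite_set_countable; apply: finite_setIl; apply: finite_setIr; exact: finite_seq.
Qed.

End piecewise_continuity.

Section fractional_integral.
Variable R : realType.
Local Notation mu := (@lebesgue_measure R).

(** Boundedness is first local, from the limit at a continuity point, or from the two side limits
    and the value at a jump; it becomes global by compactness of [c, d]. *)
Lemma PC_coord_bounded_measurable (n : nat) (c d : R) (f : R -> 'rV[R]_n) i :
  PC c d f -> bounded_measurable c d (fun s => f s 0 i).
Proof.
move=> [D [Dcd Df Dlim]]; split.
  apply: (@measurable_fun_off_seq _ c d D) => t tcd tD.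
  by apply: (@cvg_coord R n R _ f (f t)); exact: Df.
have near_bound (F : set_system R) (l : 'rV[R]_n) : Filter F ->
    f s @[s --> F] --> l -> \forall s \near F, `|f s 0 i| <= `|l| + 1.
  move=> FF /cvgrPdist_le/(_ 1 ltr01); apply: filterS => s ls.
  apply: (le_trans (rV_coord_le _ i)); rewrite -[f s](subrK l).
  by rewrite (le_trans (ler_normD _ _))// addrC lerD// distrC.
have /compact_near_coveringP cov := @segment_compact R c d.
(* The covering form of compactness is used along M -> +oo: a local bound remains valid for all
   larger M, so one M fits every point. *)
have H : \forall M \near +oo%R, [set` `[c, d]] `<=`
    (fun s => c <= s <= d -> `|f s 0 i| <= M).
  apply: cov => t; rewrite /= in_itv/= => tcd.
  suff [M HM] : exists M, \forall s \near t, c <= s <= d -> `|f s 0 i| <= M.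
    exists ([set s | c <= s <= d -> `|f s 0 i| <= M], [set N | M <= N]).
      by split => //; apply: nbhs_pinfty_ge; rewrite num_real.
    by move=> [s N] /= [fM MN] scd; exact: le_trans (fM scd) MN.
  have [tD|tD] := boolP (t \in D); last first.
    exists (`|f t| + 1).
    have : \forall s \near within `[c, d] (nbhs t), `|f s 0 i| <= `|f t| + 1.
      by apply: near_bound; exact: Df.
    by rewrite near_withinE; apply: filterS => s + scd; apply; rewrite /= in_itv.
  have [/cvg_ex[/= l fl] /cvg_ex[/= r fr]] := Dlim t tD.
  exists (Num.max (Num.max (`|l| + 1) (`|r| + 1)) `|f t 0 i|).
  apply: near_split; last first.
  - by apply: filterS (near_bound _ _ _ fr) => s H _; rewrite !le_max H orbT.
  - by move=> _; rewrite !le_max lexx orbT.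
  - by apply: filterS (near_bound _ _ _ fl) => s H _; rewrite !le_max H.
have [M HM] := filter_ex H.
by exists M => s scd; apply: HM => //; rewrite /= in_itv.
Qed.

Lemma Rintegral_itv_split (c m d : R) (f : R -> R) : c <= m -> m <= d ->
  mu.-integrable `[c, d] (EFin \o f) ->
  \int[mu]_(s in `[c, d]) f s =
  \int[mu]_(s in `[c, m]) f s + \int[mu]_(s in `[m, d]) f s.
Proof.
move=> cm md itf; rewrite -[X in _ + X]Rintegral_itv_obnd_cbnd; last first.
  by apply: integrableS itf => //; apply: subset_itv; rewrite bnd_simp.
by rewrite -(Rintegral_itvB itf)// ?bnd_simp// addrC subrK.
Qed.

(** On [s, t] the kernel has integral (t - s)^a / a. On [c, s[ the difference of the two kernels has
    constant sign, so the integral of its modulus is ((s - c)^a - (t - c)^a + (t - s)^a) / a, again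
    at most (t - s)^a / a. Hence the constant 2 M / a. *)
Lemma kernel_integral_holder (a c d M s t : R) (f : R -> R) : 0 < a <= 1 ->
  measurable_fun `[c, d] f -> (forall s, c <= s <= d -> `|f s| <= M) ->
  c <= s -> s <= t -> t <= d ->
  `|\int[mu]_(r in `[c, t]) ((t - r) `^ (a - 1) * f r) -
    \int[mu]_(r in `[c, s]) ((s - r) `^ (a - 1) * f r)| <=
  2 * M / a * (t - s) `^ a.
Proof.
move=> /andP[a0 a1] mf fM cs st td.
have bf : bounded_measurable c d f by split => //; exists M.
have bft : bounded_measurable c t f by exact: bounded_measurable_subset bf.
have bfs : bounded_measurable c s f by apply: bounded_measurable_subset bf => //; lra.
have bfst : bounded_measurable s t f by exact: bounded_measurable_subset bf.
have ikt := integrable_kernel a0 (lexx t) bft.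
have ikts := integrable_kernel a0 st bfs.
have iks := integrable_kernel a0 (lexx s) bfs.
rewrite (Rintegral_itv_split cs st ikt) addrAC -RintegralB//.
apply: (le_trans (ler_normD _ _)).
have Mts : 2 * M / a * (t - s) `^ a = M * ((t - s) `^ a / a) + M * ((t - s) `^ a / a).
  by field; rewrite gt_eqF.
rewrite Mts lerD//; last first.
  apply: (le_trans (kernel_integral_bound a0 st (lexx t) bfst.1 _)).
    by move=> r rst; apply: fM; lra.
  by rewrite subrr powR0 ?gt_eqF// subr0.
have M0 : 0 <= M by apply: le_trans (fM s _) => //; lra.
pose k (u r : R) := (u - r) `^ (a - 1).
have ikk : mu.-integrable `[c, s] (EFin \o (fun r => k s r - k t r)).
  by apply: integrableRB => //; exact: integrable_powRB.
have ikf : mu.-integrable `[c, s] (EFin \o (fun r => k t r * f r - k s r * f r)).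
  exact: integrableRB.
(* the kernel comparison fails at r = s, where 0 `^ (a - 1) = 0 *)
have sub : `[c, s[ `<=` `[c, s] by apply: subset_itv; rewrite bnd_simp.
have ikko : mu.-integrable `[c, s[ (EFin \o (fun r => k s r - k t r)).
  exact: integrableS ikk.
have ikfo : mu.-integrable `[c, s[ (EFin \o (fun r => k t r * f r - k s r * f r)).
  exact: integrableS ikf.
rewrite -Rintegral_itv_bndo_bndc//.
apply: (le_trans (le_normr_Rintegral _ ikfo)) => //.
apply: (@le_trans _ _ (\int[mu]_(r in `[c, s[) (M * (k s r - k t r)))).
  apply: le_Rintegral => //.
  - exact: integrable_norm.
  - exact: integrableRZ.
  - move=> r /=; rewrite in_itv/= => /andP[cr rs].
    have kts : k t r <= k s r by apply: powR_le0_anti; lra.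
    rewrite -mulrBl normrM [X in X * _]distrC [X in X * _]ger0_norm ?subr_ge0// mulrC.
    by rewrite ler_wpM2r ?subr_ge0//; apply: fM; lra.
rewrite RintegralZl// Rintegral_itv_bndo_bndc//.
rewrite RintegralB//; [|exact: integrable_powRB (lexx s)|exact: integrable_powRB].
rewrite !Rintegral_powRB// ler_wpM2l//.
rewrite -mulrBl ler_wpM2r ?invr_ge0 ?(ltW a0)//.
rewrite subrr powR0 ?gt_eqF// subr0 opprB.
rewrite addrC -addrA gerDl addrC subr_le0.
by apply: ge0_ler_powR; rewrite ?nnegrE; lra.
Qed.

Lemma powR_small (a C e : R) : 0 < a -> 0 <= C -> 0 < e ->
  exists2 r : R, 0 < r & forall u, 0 <= u -> u < r -> C * u `^ a <= e.
Proof.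
(* [C + 1] serves as divisor because [C] may be 0. *)
move=> a0 C0 e0; have C1 : 0 < C + 1 by rewrite ltr_wpDl.
have eC : 0 < e / (C + 1) by rewrite divr_gt0.
exists ((e / (C + 1)) `^ a^-1); first exact: powR_gt0.
move=> u u0 ur.
have : u `^ a <= e / (C + 1).
  have -> : e / (C + 1) = ((e / (C + 1)) `^ a^-1) `^ a.
    by rewrite -powRrM mulVf ?gt_eqF// powRr1// ltW.
  by apply: ge0_ler_powR; rewrite ?nnegrE ?powR_ge0//; exact: ltW.
rewrite ler_pdivlMr// mulrDr mulr1 mulrC; apply: le_trans.
by rewrite lerDl powR_ge0.
Qed.

Lemma kernel_integral_continuous (a c d : R) (f : R -> R) : 0 < a <= 1 ->
  bounded_measurable c d f -> forall t, c <= t <= d ->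
  \int[mu]_(r in `[c, s]) ((s - r) `^ (a - 1) * f r)
    @[s --> within `[c, d] (nbhs t)] -->
  \int[mu]_(r in `[c, t]) ((t - r) `^ (a - 1) * f r).
Proof.
move=> a01 [mf [M fM]] t tcd; have /andP[a0 a1] := a01.
apply/cvgrPdist_le => e e0; rewrite near_withinE.
have M0 : 0 <= M by apply: le_trans (fM t tcd).
set C := 2 * M / a.
have C0 : 0 <= C by rewrite /C !mulr_ge0// invr_ge0 ltW.
have [r r0 Cr] := powR_small a0 C0 e0.
near=> s; rewrite /= in_itv/= => scd.
have str : `|t - s| < r by near: s; exact: cvgr_dist_lt.
have [st|ts] := leP s t.
  apply: (le_trans (kernel_integral_holder a01 mf fM _ st _)); [lra|lra|].
  by apply: Cr; [lra|rewrite -(ger0_norm (x := t - s)) ?subr_ge0].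
rewrite distrC; apply: (le_trans (kernel_integral_holder a01 mf fM _ (ltW ts) _)); [lra|lra|].
by apply: Cr; [lra|rewrite -(ger0_norm (x := s - t)) ?subr_ge0 ?(ltW ts)// distrC].
Unshelve. all: by end_near. Qed.

Lemma frac_intE (n : nat) (a c : R) (f : R -> 'rV[R]_n) t i :
  frac_int a c f t 0 i =
  (Gamma a)^-1 * \int[mu]_(s in `[c, t]) ((t - s) `^ (a - 1) * f s 0 i).
Proof. by rewrite mxE. Qed.

Lemma frac_int_continuous (n : nat) (a c d : R) (f : R -> 'rV[R]_n) :
  0 < a <= 1 -> PC c d f -> {within `[c, d], continuous (frac_int a c f)}.
Proof.
move=> a01 PCf; apply/subspace_continuousP => t; rewrite /= in_itv/= => tcd.
apply: (@cvg_rV R n R (within `[c, d] (nbhs t)) (frac_int a c f)) => i.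
rewrite frac_intE; under eq_fun do rewrite frac_intE.
apply: cvgM; first exact: cvg_cst.
by apply: (@kernel_integral_continuous a c d) => //; exact: PC_coord_bounded_measurable.
Qed.

Lemma frac_int_t0 (n : nat) (a c : R) (f : R -> 'rV[R]_n) : frac_int a c f c = 0.
Proof.
by apply/rowP => i; rewrite !mxE set_itv1 Rintegral_set1 mulr0.
Qed.

End fractional_integral.

Section caputo_derivative.
Variable R : realType.
Local Notation mu := (@lebesgue_measure R).

Lemma bounded_measurableZ (c d k : R) (f : R -> R) :
  bounded_measurable c d f -> bounded_measurable c d (fun s => k * f s).
Proof.
move=> [mf [M fM]]; split; first exact: measurable_realfun.measurable_funM.
by exists (`|k| * M) => s scd; rewrite normrM ler_wpM2l// fM.
Qed.

Lemma primitive_increment (c d e l s t : R) (f : R -> R) : 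
  bounded_measurable c d f -> c <= s -> s <= t -> t <= d ->
  (forall r, s <= r <= t -> `|l - f r| <= e) ->
  `|l * (t - s) - (\int[mu]_(r in `[c, t]) f r - \int[mu]_(r in `[c, s]) f r)|
    <= e * (t - s).
Proof.
move=> bf cs st td fe.
have bft : bounded_measurable c t f by exact: bounded_measurable_subset bf.
have bfst : bounded_measurable s t f by exact: bounded_measurable_subset bft.
have ist := integrable_bounded_measurable bfst.
have cst_int (x : R) : \int[mu]_(r in `[s, t]) x = x * (t - s).
  rewrite Rintegral_cst//= lebesgue_measure_itv/= lte_fin.
  have [_|ts] := ltP s t; first by [].
  have -> : t = s by apply/eqP; rewrite eq_le ts.
  by rewrite subrr !mulr0.
have icst (x : R) : mu.-integrable `[s, t] (EFin \o cst x).
  apply: integrable_bounded_measurable; split; first exact: measurable_cst.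
  by exists `|x|.
rewrite (Rintegral_itv_split cs st (integrable_bounded_measurable bft)).
rewrite addrAC subrr add0r -cst_int -RintegralB//; last exact: icst.
have il : mu.-integrable `[s, t] (EFin \o (fun r => l - f r)).
  by apply: integrableRB => //; exact: icst.
apply: (le_trans (le_normr_Rintegral _ il)) => //.
rewrite -(cst_int e); apply: le_Rintegral => //.
- exact: integrable_norm.
- exact: icst.
Qed.

Lemma primitive_derivative (c d t : R) (f : R -> R) :
  bounded_measurable c d f -> c <= t <= d ->
  f s @[s --> within `[c, d] (nbhs t)] --> f t ->
  (s - t)^-1 * (\int[mu]_(r in `[c, s]) f r - \int[mu]_(r in `[c, t]) f r)
    @[s --> within `[c, d] t^'] --> f t.
Proof.
move=> bf /andP[ct td] ft; apply/cvgrPdist_le => e e0.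
move/cvgrPdist_le : ft => /(_ e e0); rewrite near_withinE => /nbhs_ballP[r /= r0 fr].
rewrite near_withinE near_withinE; near=> s => st; rewrite /= in_itv/= => /andP[cs sd].
have str : `|t - s| < r by near: s; exact: nbhsx_ballx.
have fe (u : R) : `|t - u| < r -> c <= u <= d -> `|f t - f u| <= e.
  by move=> tu cud; apply: fr => //=; rewrite in_itv.
have st0 : s - t != 0 by rewrite subr_eq0.
set I := (X in (s - t)^-1 * X).
have -> : f t - (s - t)^-1 * I = (s - t)^-1 * (f t * (s - t) - I) by field.
rewrite normrM normfV ler_pdivrMl ?normr_gt0// [leRHS]mulrC {}/I.
(* Exchanging s and t reverses the increment and s - t together, so the estimate for ordered points
   covers both sides of t. *)
have swap (x A B E : R) : `|x * (t - s) - (A - B)| <= E * (t - s) ->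
    `|x * (s - t) - (B - A)| <= E * - (s - t).
  have -> : x * (s - t) - (B - A) = - (x * (t - s) - (A - B)) by ring.
  by rewrite normrN [- (s - t)]opprB.
have [lst|lts] := leP s t.
  rewrite [X in _ <= _ * X]ler0_norm ?subr_le0//; apply: swap.
  apply: (primitive_increment bf cs lst td) => u /andP[su ut].
  apply: fe; last by lra.
  by move: str; rewrite !ger0_norm ?subr_ge0//; lra.
rewrite [X in _ <= _ * X]gtr0_norm ?subr_gt0//.
apply: (primitive_increment bf ct (ltW lts) sd) => u /andP[tu us].
apply: fe; last by lra.
by move: str; rewrite !ler0_norm ?subr_le0 ?(ltW lts)//; lra.
Unshelve. all: by end_near. Qed.

(** Convergence determines [lim] only along a proper filter. A nearby point of [c, d] is found to
    the right of t, or to its left when t = d. *)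
Lemma within_dnbhs_proper (c d t : R) : c < d -> c <= t <= d ->
  ProperFilter (within `[c, d] t^').
Proof.
move=> cd /andP[ct td]; apply: Build_ProperFilter_ex.
move=> A; rewrite /within /= => /nbhs_ballP[r /= r0 Ar].
have [td'|dt] := ltP t d.
- pose s := t + Num.min (r / 2) (d - t).
  have m0 : 0 < Num.min (r / 2) (d - t) by rewrite lt_min divr_gt0//= subr_gt0.
  have mr : Num.min (r / 2) (d - t) <= r / 2 by rewrite ge_min lexx.
  have md : Num.min (r / 2) (d - t) <= d - t by rewrite ge_min lexx orbT.
  exists s; apply: Ar.
  + rewrite /ball/= /s opprD addrA subrr add0r normrN gtr0_norm//; lra.
  + by rewrite /s; apply/eqP; lra.
  + by rewrite /= in_itv/= /s; lra.
- pose s := t - Num.min (r / 2) (d - c).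
  have m0 : 0 < Num.min (r / 2) (d - c) by rewrite lt_min divr_gt0//= subr_gt0.
  have mr : Num.min (r / 2) (d - c) <= r / 2 by rewrite ge_min lexx.
  have md : Num.min (r / 2) (d - c) <= d - c by rewrite ge_min lexx orbT.
  exists s; apply: Ar.
  + rewrite /ball/= /s opprB addrC subrK gtr0_norm//; lra.
  + by rewrite /s; apply/eqP; lra.
  + by rewrite /= in_itv/= /s; lra.
Qed.

(** Both cases of [caputo] reduce to this: phi for a = 1, and the integral of order 1 - a of phi -
    phi(c) for a < 1, are a constant plus a multiple of the primitive of psi. *)
Lemma derive_in_primitive (n : nat) (c d t k : R) (g f : R -> 'rV[R]_n)
    (g0 : 'rV[R]_n) : c < d -> PC c d f -> c <= t <= d -> cont_at_in c d f t ->
  (forall s i, c <= s <= d ->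
    g s 0 i = g0 0 i + k * \int[mu]_(r in `[c, s]) f r 0 i) ->
  derive_in c d g t = k *: f t.
Proof.
move=> cd PCf tcd ft gE.
have PF := within_dnbhs_proper cd tcd.
apply: cvg_lim => //; apply: cvg_rV => i.
have bf := PC_coord_bounded_measurable i PCf.
have fti : f s 0 i @[s --> within `[c, d] (nbhs t)] --> f t 0 i.
  exact: cvg_coord ft.
rewrite mxE.
apply: cvg_trans (cvgM (cvg_cst k) (primitive_derivative bf tcd fti)).
apply: near_eq_cvg; rewrite near_withinE near_withinE; near=> s => _.
rewrite /= in_itv/= => scd.
by rewrite !mxE !gE// mulrCA; congr (_ * _); ring.
Unshelve. all: by end_near. Qed.

(* Here K = B(a, 1 - a) / (Gamma a Gamma (1 - a)) = 1, but only K != 0 is needed. *)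
Lemma caputo_frac_int (a : R) : 0 < a <= 1 -> exists2 K : R, K != 0 &
  forall (n : nat) (c d : R) (phi psi : R -> 'rV[R]_n), c < d -> PC c d psi ->
    (forall t, c <= t <= d -> phi t = phi c + frac_int a c psi t) ->
  forall t, c <= t <= d -> cont_at_in c d psi t ->
    caputo a c d phi t = K *: psi t.
Proof.
move=> a01; have /andP[a0 a1] := a01.
have Ga0 : Gamma a != 0 by rewrite gt_eqF// Gamma_gt0.
rewrite /caputo; have [->|a_neq1] := eqVneq a 1.
  (* For a = 1 the kernel is a zeroth power, equal to 1 even at base 0, so phi is already a
     primitive up to this factor. *)
  exists (Gamma (1 : R))^-1; first by rewrite invr_eq0 gt_eqF// Gamma_gt0// ltr01 lexx.
  move=> n c d phi psi cd PCpsi phiE t tcd psit.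
  apply: (derive_in_primitive (g0 := phi c)) => // s i scd.
  rewrite phiE// mxE frac_intE; congr (_ + _ * _).
  by apply: eq_Rintegral => r _; rewrite subrr powRr0 mul1r.
have a_lt1 : a < 1 by rewrite lt_neqAle a_neq1.
have G1a0 : Gamma (1 - a) != 0 by rewrite gt_eqF// Gamma_gt0//; lra.
have /andP[B0 By] : (0 < beta_integral a < +oo)%E.
  by apply: beta_integral_gt0; rewrite a0.
exists ((Gamma (1 - a))^-1 * fine (beta_integral a) * (Gamma a)^-1).
  by rewrite !mulf_neq0 ?invr_eq0// gt_eqF// fine_gt0// B0.
move=> n c d phi psi cd PCpsi phiE t tcd psit.
apply: (derive_in_primitive (g0 := 0)) => // s i scd.
have bpsi := PC_coord_bounded_measurable i PCpsi.
rewrite frac_intE mxE add0r -!mulrA; congr (_ * _).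
have bs : bounded_measurable c s (fun r => psi r 0 i).
  by apply: bounded_measurable_subset bpsi => //; lra.
rewrite -RintegralZl//; last exact: integrable_bounded_measurable.
(* The factor 1 / Gamma(a) has been moved inside, so that the semigroup law collapses the two
   fractional integrals into one primitive. *)
rewrite -(@fractional_semigroup R a c d s) ?a0//; last exact: bounded_measurableZ.
apply: eq_Rintegral => r; rewrite inE/= in_itv/= => /andP[cr rs].
have rcd : c <= r <= d by lra.
have br : bounded_measurable c r (fun r => psi r 0 i).
  by apply: bounded_measurable_subset bpsi => //; lra.
rewrite !mxE phiE// mxE addrAC subrr add0r frac_intE; congr (_ * _).
rewrite -RintegralZl//; last exact: integrable_kernel.
by apply: eq_Rintegral => u _; rewrite mulrCA.
Qed.

End caputo_derivative.

(** * Square waves with small fractional integral *)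

Section square_wave.
Variable R : realType.
Local Notation mu := (@lebesgue_measure R).

(** Side limits are asked for at every point and not only on [D], because in a sum a jump of one
    term may be a continuity point of the other. The jumps lie strictly inside, as [PC] demands. *)
Definition jumps_in (c d : R) (r : R -> R) : Prop :=
  exists D : seq R, [/\ forall s, s \in D -> c < s < d,
    forall s, s \notin D -> r u @[u --> s] --> r s &
    forall s, cvg (r u @[u --> s^'-]) /\ cvg (r u @[u --> s^'+])].

Lemma jumps_in_cst (c d k : R) : jumps_in c d (fun=> k).
Proof.
exists [::]; split=> // [s _|s]; first exact: cvg_cst.
by split; exact: is_cvg_cst.
Qed.

Lemma jumps_inD (c d : R) (r1 r2 : R -> R) : jumps_in c d r1 ->
  jumps_in c d r2 -> jumps_in c d (fun s => r1 s + r2 s).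
Proof.
move=> [D1 [D1cd c1 l1]] [D2 [D2cd c2 l2]]; exists (D1 ++ D2); split.
- by move=> s; rewrite mem_cat => /orP[/D1cd|/D2cd].
- move=> s; rewrite mem_cat negb_or => /andP[s1 s2].
  by apply: cvgD; [exact: c1|exact: c2].
- move=> s; have [l1l l1r] := l1 s; have [l2l l2r] := l2 s.
  by split; apply: is_cvgD.
Qed.

Lemma jumps_inZ (c d k : R) (r : R -> R) : jumps_in c d r ->
  jumps_in c d (fun s => k * r s).
Proof.
move=> [D [Dcd cD l]]; exists D; split=> // s.
- by move=> sD; apply: cvgM; [exact: cvg_cst|exact: cD].
- by have [ll lr] := l s; split; apply: is_cvgM => //; exact: is_cvg_cst.
Qed.

(** Half-open, so that consecutive cells tile an interval without overlap. *)
Definition cell (x d : R) : R -> R := fun s => if x <= s < x + d then 1 else 0.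

Lemma jumps_in_cell (c d x h : R) : c < x -> x + h < d -> 0 < h ->
  jumps_in c d (cell x h).
Proof.
move=> cx xhd h0.
have near_cst (k : R) (F : set_system R) : Filter F ->
    (\forall u \near F, cell x h u = k) -> cell x h u @[u --> F] --> k.
  by move=> FF; exact: cvg_near_cst.
exists [:: x; x + h]; split.
- by move=> s; rewrite !inE => /orP[] /eqP->; lra.
- move=> s; rewrite !inE negb_or => /andP[sx sxh]; apply: (near_cst (cell x h s) (nbhs s)).
  have [sltx|xlts|sE] := ltgtP s x; last by rewrite sE eqxx in sx.
    near=> u; have us : u < x by near: u; exact: lt_nbhsl.
    by rewrite /cell !ifF//; apply/negbTE; rewrite negb_and -!ltNge ?us// sltx.
  have [sltxh|xhlts|sE] := ltgtP s (x + h); last by rewrite sE eqxx in sxh.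
    near=> u; have us : u < x + h by near: u; exact: lt_nbhsl.
    have ux : x < u by near: u; exact: lt_nbhsr.
    by rewrite /cell !ifT//; [rewrite (ltW xlts)|rewrite (ltW ux)].
  near=> u; have us : x + h < u by near: u; exact: lt_nbhsr.
  by rewrite /cell !ifF//; apply/negbTE; rewrite negb_and -!leNgt ?(ltW us) ?(ltW xhlts) orbT.
- move=> s; split; apply/cvg_ex.
    have [sx|xs] := leP s x.
      exists 0; apply: (near_cst _ s^'-); near=> u.
      have us : u < s by near: u; exact: nbhs_left_lt.
      by rewrite /cell ifF//; apply/negbTE; rewrite negb_and -!ltNge (lt_le_trans us sx).
    have [sxh|xhs] := leP s (x + h).
      exists 1; apply: (near_cst _ s^'-); near=> u.
      have us : u < s by near: u; exact: nbhs_left_lt.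
      have xu : x < u by near: u; exact: nbhs_left_gt.
      by rewrite /cell ifT// (ltW xu)/=; lra.
    exists 0; apply: (near_cst _ s^'-); near=> u.
    have xu : x + h < u by near: u; exact: nbhs_left_gt.
    by rewrite /cell ifF//; apply/negbTE; rewrite negb_and -!leNgt (ltW xu) orbT.
  have [xhs|sxh] := leP (x + h) s.
    exists 0; apply: (near_cst _ s^'+); near=> u.
    have su : s < u by near: u; exact: nbhs_right_gt.
    by rewrite /cell ifF//; apply/negbTE; rewrite negb_and -!leNgt (ltW (le_lt_trans xhs su)) orbT.
  have [xs|sx] := leP x s.
    exists 1; apply: (near_cst _ s^'+); near=> u.
    have su : s < u by near: u; exact: nbhs_right_gt.
    have uxh : u < x + h by near: u; exact: nbhs_right_lt.
    by rewrite /cell ifT// uxh andbT; lra.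
  exists 0; apply: (near_cst _ s^'+); near=> u.
  have ux : u < x by near: u; exact: nbhs_right_lt.
  by rewrite /cell ifF//; apply/negbTE; rewrite negb_and -!ltNge ux.
Unshelve. all: by end_near. Qed.

Lemma Rintegral0_eq (D : set R) (f : R -> R) :
  (forall s, D s -> f s = 0) -> \int[mu]_(s in D) f s = 0.
Proof.
by move=> f0; rewrite /Rintegral integral0_eq// => s Ds; rewrite f0.
Qed.

Lemma bounded_measurable_jumps_in (c d M : R) (r : R -> R) :
  jumps_in c d r -> (forall s, `|r s| <= M) -> bounded_measurable c d r.
Proof.
move=> [D [_ rD _]] rM; split; last by exists M => s _.
apply: (@measurable_fun_off_seq _ c d D) => t _ tD.
by apply: cvg_within_filter; exact: rD.
Qed.

(** In x^a = x * x^(a - 1) the second factor is nonincreasing, so that passing from u + v to u, or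
    to v, only raises it. *)
Lemma powR_subadditive (a u v : R) : 0 < a <= 1 -> 0 <= u -> 0 <= v ->
  (u + v) `^ a <= u `^ a + v `^ a.
Proof.
move=> /andP[a0 a1]; rewrite le_eqVlt => /predU1P[<-|u0].
  by rewrite add0r powR0 ?gt_eqF// add0r.
rewrite le_eqVlt => /predU1P[<-|v0].
  by rewrite addr0 powR0 ?gt_eqF// addr0.
have split_pow x : 0 < x -> x `^ a = x * x `^ (a - 1).
  by move=> x0; rewrite -{2}(powRr1 (ltW x0)) -powRD ?(gt_eqF x0) ?implybT// addrC subrK.
rewrite !split_pow// ?addr_gt0// mulrDl.
by rewrite lerD// ler_pM2l// powR_le0_anti//; lra.
Qed.

Section wave_integral.
Variables (a t0 t1 : R).
Hypotheses (a01 : 0 < a <= 1) (t01 : t0 < t1).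

Definition dual_weight (s : R) : R := (t1 - s) `^ (1 - a).

Local Notation w := dual_weight.

Local Notation W := (dual_weight t0).

Definition wave_integral (t : R) (r : R -> R) : R :=
  \int[mu]_(s in `[t0, t]) ((t - s) `^ (a - 1) * (w s * r s)).

Local Notation wave := wave_integral.

Let a_gt0 : 0 < a. Proof. by have /andP[] := a01. Qed.

Let w_ge0 s : 0 <= w s. Proof. exact: powR_ge0. Qed.

Let w_le s : t0 <= s <= t1 -> w s <= W.
Proof.
move=> s01; have /andP[_ a1] := a01.
by apply: ge0_ler_powR; rewrite ?nnegrE; lra.
Qed.

Let measurable_w (D : set R) : measurable D -> measurable_fun D w.
Proof. exact: measurable_fun_powRB. Qed.

Let bounded_measurable_w : bounded_measurable t0 t1 w.
Proof.
by split; [exact: measurable_w|exists W => s /w_le; rewrite ger0_norm].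
Qed.

Lemma bounded_measurableM (c d : R) (f g : R -> R) : bounded_measurable c d f ->
  bounded_measurable c d g -> bounded_measurable c d (fun s => f s * g s).
Proof.
move=> [mf [M fM]] [mg [N gN]]; split; first exact: measurable_realfun.measurable_funM.
by exists (M * N) => s scd; rewrite normrM ler_pM// ?fM// gN.
Qed.

Let integrable_wave (t : R) (r : R -> R) : t0 <= t <= t1 ->
  bounded_measurable t0 t1 r ->
  mu.-integrable `[t0, t] (fun s : R => ((t - s) `^ (a - 1) * (w s * r s))%:E).
Proof.
move=> /andP[t0t tt1] br; apply: (integrable_kernel (f := fun s => w s * r s)) => //.
apply: bounded_measurableM.
  exact: bounded_measurable_subset bounded_measurable_w.
exact: bounded_measurable_subset br.
Qed.

Let waveD (t : R) (r1 r2 : R -> R) : t0 <= t <= t1 ->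
  bounded_measurable t0 t1 r1 -> bounded_measurable t0 t1 r2 ->
  wave t (fun s => r1 s + r2 s) = wave t r1 + wave t r2.
Proof.
move=> tt br1 br2; rewrite /wave -RintegralD//; [|exact: integrable_wave..].
by apply: eq_Rintegral => s _; rewrite !mulrDr.
Qed.

Let waveN (t : R) (r : R -> R) : t0 <= t <= t1 -> bounded_measurable t0 t1 r ->
  wave t (fun s => - 1 * r s) = - wave t r.
Proof.
move=> tt br; rewrite -[RHS]mulN1r /wave -RintegralZl//; last exact: integrable_wave.
by apply: eq_Rintegral => s _; rewrite !mulN1r !mulrN.
Qed.

Lemma bounded_measurable_cell (c d x h : R) : bounded_measurable c d (cell x h).
Proof.
split; last by exists 1 => s _; rewrite /cell; case: ifP; rewrite ?normr1// normr0.
rewrite (_ : cell x h = \1_(`[x, x + h[%classic)).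
  exact: measurable_indic.
by apply/funext => s; rewrite indicE /cell mem_setE in_itv/=; case: ifP.
Qed.

Lemma Rintegral_cell (c d x h : R) (g : R -> R) :
  \int[mu]_(s in `[c, d]) (g s * cell x h s) =
  \int[mu]_(s in `[c, d] `&` `[x, x + h[) g s.
Proof.
rewrite Rintegral_mkcondr; apply: eq_Rintegral => s _.
rewrite patchE mem_setE in_itv/= /cell.
by case: ifP => _; rewrite ?mulr1 ?mulr0.
Qed.

Let wave_cellE (t x h : R) : wave t (cell x h) =
  \int[mu]_(s in `[t0, t] `&` `[x, x + h[) ((t - s) `^ (a - 1) * w s).
Proof.
by rewrite -Rintegral_cell; apply: eq_Rintegral => s _; rewrite mulrA.
Qed.

Let wave_cell_lt (t x h : R) : t < x -> wave t (cell x h) = 0.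
Proof.
move=> tx; rewrite wave_cellE [_ `&` _](_ : _ = set0) ?Rintegral_set0//.
by apply/seteqP; split=> // s [] /=; rewrite !in_itv/=; lra.
Qed.

Let wave_cell_full (t x h : R) : t0 <= x -> 0 < h -> x + h <= t ->
  wave t (cell x h) = \int[mu]_(s in `[x, x + h[) ((t - s) `^ (a - 1) * w s).
Proof.
move=> t0x h0 xht; rewrite wave_cellE [_ `&` _](_ : _ = [set` `[x, x + h[])//.
by apply/seteqP; split=> [s []//|s /=]; rewrite !in_itv/= => H; split=> //; lra.
Qed.

Let wave_cell_ge0 (t x h : R) : 0 <= wave t (cell x h).
Proof.
by rewrite wave_cellE; apply: Rintegral_ge0 => s _; rewrite mulr_ge0 ?powR_ge0.
Qed.

(** By subadditivity of u -> u^a the kernel has integral at most h^a / a over a cell of length h,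
    wherever it lies with respect to t; the weight is at most its value at t0. *)
Let wave_cell_le (t x h : R) : t0 <= t <= t1 -> t0 <= x -> 0 < h ->
  wave t (cell x h) <= W * (h `^ a / a).
Proof.
move=> /andP[t0t tt1] t0x h0.
have kge0 : 0 <= W * (h `^ a / a).
  by rewrite mulr_ge0 ?powR_ge0// divr_ge0 ?powR_ge0 ?(ltW a_gt0).
have [xt|/wave_cell_lt ->//] := leP x t.
have bound m : x <= m -> m <= t -> (t - x) `^ a - (t - m) `^ a <= h `^ a ->
    \int[mu]_(s in `[x, m]) ((t - s) `^ (a - 1) * w s) <= W * (h `^ a / a).
  move=> xm mt H; apply: (le_trans (ler_norm _)).
  apply: (le_trans (@kernel_integral_bound R a x m t W w a_gt0 xm mt _ _)).
  - exact: measurable_w.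
  - by move=> s xsm; rewrite ger0_norm// w_le//; lra.
  - by rewrite ler_wpM2l ?powR_ge0// ler_wpM2r ?invr_ge0 ?(ltW a_gt0).
have [xht|txh] := leP (x + h) t.
  rewrite wave_cell_full// Rintegral_itv_bndo_bndc; last first.
    apply: integrableS (integrable_kernel a_gt0 xht _) => //.
      by apply: subset_itv; rewrite bnd_simp.
    by apply: bounded_measurable_subset bounded_measurable_w; lra.
  apply: bound => //; first by lra.
  rewrite lerBlDl (_ : t - x = t - (x + h) + h); last by ring.
  by apply: powR_subadditive => //; lra.
rewrite wave_cellE [_ `&` _](_ : _ = [set` `[x, t]]); last first.
  apply/seteqP; split=> [s []|s]; rewrite /= !in_itv/=; first by lra.
  by move=> H; split; lra.
apply: bound => //; rewrite subrr powR0 ?gt_eqF// subr0.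
by apply: ge0_ler_powR; rewrite ?nnegrE ?(ltW a_gt0)//; lra.
Qed.

(** The product is the power 1 - a of (t1 - s) / (t - s) = 1 + (t1 - t) / (t - s), which grows with
    s. After cross-multiplication the difference is (t1 - t) (s' - s). *)
Let kernel_mono (t s s' : R) : s <= s' -> s' < t -> t <= t1 ->
  (t - s) `^ (a - 1) * w s <= (t - s') `^ (a - 1) * w s'.
Proof.
move=> ss' s't tt1; have /andP[a0 a1] := a01.
have inv (u : R) : u `^ (a - 1) = (u `^ (1 - a))^-1 by rewrite -powRN opprB.
rewrite !inv ler_pdivrMl ?powR_gt0; [|lra..].
rewrite mulrA mulrAC ler_pdivlMr ?powR_gt0; [|lra..].
rewrite /w -!powRM; [|lra..].
apply: ge0_ler_powR; rewrite ?nnegrE; [lra|apply: mulr_ge0; lra..|].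
rewrite -subr_ge0 (_ : _ - _ = (t1 - t) * (s' - s)); last by ring.
by rewrite mulr_ge0; lra.
Qed.

Let wave_cell_mono (t x x' h : R) : t0 <= x -> t <= t1 -> 0 < h ->
  x + h <= x' -> x' + h <= t -> wave t (cell x h) <= wave t (cell x' h).
Proof.
move=> t0x tt1 h0 xx' x't; pose g s := (t - s) `^ (a - 1) * w s.
have ig y : t0 <= y -> y + h <= t -> mu.-integrable `[y, y + h[ (EFin \o g).
  move=> t0y yt; apply: integrableS (integrable_kernel a_gt0 yt _) => //.
    by apply: subset_itv; rewrite bnd_simp.
  by apply: bounded_measurable_subset bounded_measurable_w; lra.
have ic y : mu.-integrable `[y, y + h[ (EFin \o cst (g x')).
  have bc : bounded_measurable y (y + h) (cst (g x')).
    by split; [exact: measurable_cst|exists `|g x'|].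
  apply: integrableS (integrable_bounded_measurable bc) => //.
  by apply: subset_itv; rewrite bnd_simp.
have cstE y : \int[mu]_(s in `[y, y + h[) g x' = g x' * h.
  rewrite Rintegral_cst//= lebesgue_measure_itv/= lte_fin ltrDl h0/=.
  by rewrite addrAC subrr add0r.
rewrite !wave_cell_full//; [|lra..].
(* The value at the start of the later cell separates the two: it bounds the integrand from above on
   the earlier cell and from below on the later one. *)
apply: (@le_trans _ _ (g x' * h)).
  rewrite -(cstE x); apply: le_Rintegral => //; first by apply: ig; lra.
  by move=> s; rewrite /= in_itv/= => sx; apply: kernel_mono; lra.
rewrite -(cstE x'); apply: le_Rintegral => //; first by apply: ig; lra.
by move=> s; rewrite /= in_itv/= => sx; apply: kernel_mono; lra.
Qed.

Definition cell_bound (h : R) : R := W * (h `^ a / a).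

Local Notation kappa := cell_bound.

(* With P = p + 2 N h the right end of the wave: as the cell integrals of the
   kernel increase, the alternating sum is nonpositive once t passed P, and
   dominated by the integral over any later cell. *)
Lemma square_wave_pairs (p h : R) (N : nat) : 0 < h -> t0 < p ->
  p + N%:R * (2 * h) < t1 ->
  exists r : R -> R, [/\ jumps_in t0 t1 r,
    forall s, r s = (if p <= s < p + N%:R * (2 * h) then r s else 0),
    forall s, p <= s < p + N%:R * (2 * h) -> r s = 1 \/ r s = -1,
    \int[mu]_(s in `[t0, t1]) r s = 0 &
    forall t, t0 <= t <= t1 -> `|wave t r| <= 2 * kappa h /\
      (p + N%:R * (2 * h) <= t ->
        [/\ wave t r <= 0, - kappa h <= wave t r &
          forall x, p + N%:R * (2 * h) <= x -> x + h <= t ->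
            - wave t (cell x h) <= wave t r])].
Proof.
move=> h0 t0p; have k0 : 0 <= kappa h.
  by rewrite /kappa mulr_ge0 ?powR_ge0// divr_ge0 ?powR_ge0 ?(ltW a_gt0).
elim: N => [|N IH].
  rewrite mul0r addr0 => pt1; exists (fun=> 0).
  have wave0 t : wave t (fun=> 0) = 0.
    by rewrite /wave Rintegral0_eq// => s _; rewrite !mulr0.
  split.
  - exact: jumps_in_cst.
  - by move=> s; rewrite if_same.
  - by move=> s; lra.
  - by rewrite Rintegral0_eq.
  - move=> t _; rewrite wave0 normr0; split; first by rewrite mulr_ge0.
    by move=> _; split=> // [|x _ _]; rewrite oppr_le0.
set P := p + N%:R * (2 * h) in IH *.
have -> : p + N.+1%:R * (2 * h) = P + 2 * h by rewrite /P -natr1; ring.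
move=> Pt1; have [|r [rJ r0 r1 rint rw]] := IH; first by lra.
have pP : p <= P by rewrite lerDl mulr_ge0// mulr_ge0 ?ltW.
(* A pair of cells is appended, plus on [P, P + h[ and minus on [P + h, P + 2 h[, so that the
   integral remains 0. *)
pose r' (s : R) := r s + (cell P h s + - 1 * cell (P + h) h s).
have cellE x s : cell x h s = if x <= s < x + h then 1 else 0 by [].
have r_le1 s : `|r s| <= 1.
  rewrite r0; case: ifP => [/r1[]->|_]; rewrite ?normrN ?normr1//.
  by rewrite normr0.
have br := bounded_measurable_jumps_in rJ r_le1.
have bc x : bounded_measurable t0 t1 (cell x h) by exact: bounded_measurable_cell.
have bnc x : bounded_measurable t0 t1 (fun s => - 1 * cell x h s).
  exact: bounded_measurableZ.
have bcc : bounded_measurable t0 t1 (fun s => cell P h s + - 1 * cell (P + h) h s).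
  apply: (@bounded_measurable_jumps_in _ _ 2).
    apply: jumps_inD; first by apply: jumps_in_cell; lra.
    by apply: jumps_inZ; apply: jumps_in_cell; lra.
  move=> s; apply: (le_trans (ler_normD _ _)); rewrite !cellE.
  by rewrite -(@natr1 R 1) lerD//; case: ifP; rewrite ?mulr0 ?mulr1 ?normrN ?normr1 ?normr0.
have waveE t : t0 <= t <= t1 ->
    wave t r' = wave t r + (wave t (cell P h) - wave t (cell (P + h) h)).
  by move=> tt; rewrite waveD// waveD// waveN.
exists r'; split.
- apply: jumps_inD => //; apply: jumps_inD; first by apply: jumps_in_cell; lra.
  by apply: jumps_inZ; apply: jumps_in_cell; lra.
- move=> s; case: ifP => // /negbT H; rewrite /r' r0 !cellE.
  by rewrite !ifF ?mulr0 ?addr0//; lra.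
- move=> s /andP[ps sP]; have [sltP|Ps] := ltP s P.
    have -> : r' s = r s.
      by rewrite /r' !cellE !ifF ?mulr0 ?addr0//; lra.
    by apply: r1; rewrite ps.
  have rs0 : r s = 0 by rewrite r0 ifF//; lra.
  rewrite /r' rs0 add0r !cellE.
  have [sPh|Phs] := ltP s (P + h).
    by left; rewrite ifT ?ifF ?mulr0 ?addr0//; lra.
  by right; rewrite ifF ?ifT ?mulr1 ?add0r//; lra.
- rewrite /r' RintegralD//; [|exact: integrable_bounded_measurable..].
  rewrite rint add0r RintegralD//; [|exact: integrable_bounded_measurable..].
  rewrite RintegralZl//; last exact: integrable_bounded_measurable.
  have cint x : t0 <= x -> x + h <= t1 -> \int[mu]_(s in `[t0, t1]) cell x h s = h.
    move=> t0x xt1; have := Rintegral_cell t0 t1 x h (fun=> 1).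
    under eq_Rintegral do rewrite mul1r.
    move=> ->; rewrite [_ `&` _](_ : _ = [set` `[x, x + h[]); last first.
      by apply/seteqP; split=> [s []//|s /=]; rewrite !in_itv/= => H; split=> //; lra.
    rewrite Rintegral_cst//= lebesgue_measure_itv/= lte_fin ltrDl h0/=.
    by rewrite mul1r addrAC subrr add0r.
  by rewrite !cint ?mulN1r ?subrr//; lra.
- move=> t tt; have [rw1 rw2] := rw t tt; have /andP[t0t tt1] := tt.
  have t0P : t0 <= P by lra.
  have t0Ph : t0 <= P + h by lra.
  have c1 := wave_cell_le tt t0P h0.
  have c2 := wave_cell_le tt t0Ph h0.
  have c10 := wave_cell_ge0 t P h.
  have c20 := wave_cell_ge0 t (P + h) h.
  rewrite waveE//; rewrite -/(kappa h) in c1 c2.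
  split.
    have [Pt|tP] := leP P t; last first.
      by rewrite !wave_cell_lt ?subrr ?addr0//; lra.
    (* The old wave lies in [-kappa, 0] and each new cell in [0, kappa], so the value lies in
       [-2 kappa, kappa] even for t inside the new pair. *)
    have [rw3 rw4 _] := rw2 Pt.
    by rewrite ler_norml; apply/andP; split; lra.
  move=> P2t; have [|rw3 rw4 rw5] := rw2; first by lra.
  have mono1 : wave t (cell P h) <= wave t (cell (P + h) h).
    by apply: wave_cell_mono => //; lra.
  (* The old wave plus the new positive cell is thus nonnegative; after the negative cell the total
     is at least minus that last cell, which gives both lower bounds. *)
  have low : - wave t (cell P h) <= wave t r by apply: rw5; lra.
  split; [by lra|by lra|].
  move=> x Px xt; have : wave t (cell (P + h) h) <= wave t (cell x h).
    by apply: wave_cell_mono => //; lra.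
  by lra.
Qed.

Lemma square_wave_exists (p q e : R) : t0 < p -> p < q -> q < t1 -> 0 < e ->
  exists r : R -> R, [/\ jumps_in t0 t1 r,
    forall s, ~~ (p <= s < q) -> r s = 0,
    forall s, p <= s < q -> r s = 1 \/ r s = -1,
    \int[mu]_(s in `[t0, t1]) r s = 0 &
    forall t, t0 <= t <= t1 ->
      `|\int[mu]_(s in `[t0, t]) ((t - s) `^ (a - 1) * ((t1 - s) `^ (1 - a) * r s))|
        <= e].
Proof.
move=> t0p pq qt1 e0; have pq0 : 0 < q - p by rewrite subr_gt0.
have C0 : 0 <= 2 * W / a by rewrite divr_ge0 ?mulr_ge0 ?powR_ge0 ?(ltW a_gt0).
have [u u0 uC] := powR_small a_gt0 C0 e0.
have [N N0 Nu] : exists2 N : nat, (0 < N)%N & (q - p) / (N%:R * 2) < u.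
  exists (Num.bound ((q - p) / u)).+1 => //.
  have : (q - p) / u < (Num.bound ((q - p) / u))%:R.
    by apply: archi_boundP; rewrite divr_ge0 ?(ltW pq0) ?(ltW u0).
  rewrite ltr_pdivrMr// => H; rewrite ltr_pdivrMr ?mulr_gt0 ?ltr0n//.
  apply: (lt_le_trans H); rewrite mulrC ler_pM2l// -natrM ler_nat.
  by rewrite muln2 -addnn; apply: (leq_trans (leqnSn _)); rewrite leq_addl.
pose h := (q - p) / (N%:R * 2).
have NR0 : 0 < N%:R :> R by rewrite ltr0n.
have h0 : 0 < h by rewrite divr_gt0 ?mulr_gt0.
have qE : p + N%:R * (2 * h) = q by rewrite /h; field; rewrite gt_eqF.
have := @square_wave_pairs p h N h0 t0p; rewrite qE => /(_ qt1).
move=> [r [rJ r0 r1 rint rw]]; exists r; split=> //.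
- by move=> s H; rewrite r0 (negbTE H).
- move=> t /rw[rw1 _]; apply: (le_trans rw1).
  have := uC h (ltW h0) Nu; apply: le_trans; rewrite /kappa le_eqVlt.
  by apply/orP; left; apply/eqP; field; rewrite gt_eqF.
Qed.

End wave_integral.

End square_wave.

(** * Variation of the functional *)

Section graph_neighborhood.
Variables (R : realType) (n : nat) (t0 t1 : R).
Variables (L : R -> 'rV[R]_n -> 'rV[R]_n -> R).
Variables (U : set (R * 'rV[R]_n * 'rV[R]_n)).
Hypotheses (oU : open U) (LU : forall p, U p ->
  {for p, continuous (fun q : R * 'rV[R]_n * 'rV[R]_n => L q.1.1 q.1.2 q.2)}).

Lemma near_uniform (p : R * 'rV[R]_n * 'rV[R]_n) (e : R) : U p -> 0 < e ->
  exists2 r, 0 < r & forall s x y, `|p.1.1 - s| < r -> `|p.1.2 - x| < r ->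
    `|p.2 - y| < r ->
    U (s, x, y) /\ `|L p.1.1 p.1.2 p.2 - L s x y| < e.
Proof.
move=> Up e0.
have : \forall q \near p, U q /\ `|L p.1.1 p.1.2 p.2 - L q.1.1 q.1.2 q.2| < e.
  near=> q; split; near: q; first by apply: open_nbhs_nbhs.
  by have /cvgrPdist_lt := LU Up; exact.
move=> /nbhs_ballP[r r0 rP]; exists r => // s x y ps px py.
by apply: (rP (s, x, y)); split=> /=; [split|]; rewrite -ball_normE.
Unshelve. all: by end_near. Qed.

Variables (x0 y0 : R -> 'rV[R]_n).

(** One radius plays three roles: width of a tube inside U, modulus of continuity of L in x and,
    through its inverse, bound of L on the graph. The property thus passes to smaller radii, and
    compactness can be used as r -> 0+. *)
Definition graph_stable (e r : R) (s : R) : Prop := forall z : 'rV[R]_n, `|z| < r ->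
  [/\ U (s, x0 s + z, y0 s), `|L s (x0 s + z) (y0 s) - L s (x0 s) (y0 s)| <= e &
      `|L s (x0 s) (y0 s)| <= r^-1].

Let graph_stable_le (e r r' s : R) : 0 < r -> r <= r' -> graph_stable e r' s -> graph_stable e r s.
Proof.
move=> r0 rr' H z zr; have [|H1 H2 H3] := H z; first exact: lt_le_trans rr'.
split=> //; apply: (le_trans H3); rewrite lef_pV2 ?posrE//.
exact: lt_le_trans rr'.
Qed.

(** The filter is left open to cover a neighborhood within [t0, t1] as well as each side of a jump,
    [l] being the value or the side limit of the derivative. *)
Let near_graph_stable (F : set_system R) (t e : R) (l : 'rV[R]_n) : Filter F ->
  s @[s --> F] --> t -> x0 s @[s --> F] --> x0 t -> y0 s @[s --> F] --> l ->
  U (t, x0 t, l) -> 0 < e ->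
  exists2 r, 0 < r & \forall s \near F, graph_stable e r s.
Proof.
(* The 1 bounds L on the graph by C below; e / 2 is for comparing two points through (t, x0 t,
   l). *)
move=> FF Ft Fx Fy Up e0; have e20 : 0 < Num.min 1 (e / 2).
  by rewrite lt_min ltr01 divr_gt0.
have [r r0 rP] := near_uniform Up e20.
pose C := `|L t (x0 t) l| + 1.
have C0 : 0 < C by rewrite ltr_wpDl.
have r20 : 0 < Num.min (r / 2) C^-1 by rewrite lt_min divr_gt0//= invr_gt0.
have r2r : Num.min (r / 2) C^-1 <= r / 2 by rewrite ge_min lexx.
have r2C : Num.min (r / 2) C^-1 <= C^-1 by rewrite ge_min lexx orbT.
exists (Num.min (r / 2) C^-1) => //.
have h0 : 0 < r / 2 by rewrite divr_gt0.
have hr : r / 2 < r by lra.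
move/cvgrPdist_lt : Ft => /(_ _ h0) Ft; move/cvgrPdist_lt : Fx => /(_ _ h0) Fx.
move/cvgrPdist_lt : Fy => /(_ _ h0) Fy.
apply: filterS3 Ft Fx Fy => s st sx sy z zr.
have [_ E0] := rP s (x0 s) (y0 s) (lt_trans st hr) (lt_trans sx hr) (lt_trans sy hr).
have [|U1 E1] := rP s (x0 s + z) (y0 s) (lt_trans st hr) _ (lt_trans sy hr).
  rewrite opprD addrA; apply: (le_lt_trans (ler_normB _ _)).
  by rewrite [ltRHS](splitr r) ltrD// (lt_le_trans zr).
rewrite /= in E0 E1; rewrite !lt_min in E0 E1.
have /andP[E01 E02] := E0; have /andP[E11 E12] := E1.
split=> //.
  rewrite -(subrKA (L t (x0 t) l)); apply: (le_trans (ler_normD _ _)).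
  by rewrite distrC (splitr e) lerD// ltW// distrC.
rewrite -[L s _ _](subKr (L t (x0 t) l)).
apply: (@le_trans _ _ C); last first.
  by rewrite -[leLHS]invrK lef_pV2 ?posrE ?invr_gt0.
by apply: (le_trans (ler_normB _ _)); rewrite lerD// ltW.
Qed.

(** At a jump of [y0] the two limit points, both in U, take the place of the value; compactness of
    [t0, t1] then gives a common radius. *)
Lemma graph_uniform (D : seq R) (e : R) : t0 < t1 ->
  {within `[t0, t1], continuous x0} ->
  (forall t, t \in D -> t0 < t < t1) ->
  (forall t, t0 <= t <= t1 -> t \notin D -> cont_at_in t0 t1 y0 t /\ U (t, x0 t, y0 t)) ->
  (forall t, t \in D -> exists l r, [/\ y0 s @[s --> t^'-] --> l, 
     y0 s @[s --> t^'+] --> r, U (t, x0 t, l) & U (t, x0 t, r)]) -> 0 < e ->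
  exists2 r, 0 < r & forall s, t0 <= s <= t1 -> s \notin D -> graph_stable e r s.
Proof.
move=> t01 x0c Dt yc yD e0.
have xc t : t0 <= t <= t1 -> x0 s @[s --> within `[t0, t1] (nbhs t)] --> x0 t.
  by move=> tt; move/subspace_continuousP : x0c => /(_ t); apply; rewrite /= in_itv.
have /compact_near_coveringP cov := @segment_compact R t0 t1.
have H : \forall r \near 0^'+, [set` `[t0, t1]] `<=`
    (fun s => t0 <= s <= t1 -> s \notin D -> graph_stable e r s).
  apply: cov => t; rewrite /= in_itv/= => tt.
  suff [r r0 H] : exists2 r, 0 < r & \forall s \near t, t0 <= s <= t1 -> s \notin D -> graph_stable e r s.
    exists ([set s | t0 <= s <= t1 -> s \notin D -> graph_stable e r s], [set r' | 0 < r' /\ r' <= r]).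
      split => //=; near=> r'; split; near: r'; first exact: nbhs_right_gt.
      exact: nbhs_right_le.
    by move=> [s r'] /= [H1 [r'0 r'r]] st sD; apply: graph_stable_le (H1 st sD).
  have [tD|tD] := boolP (t \in D); last first.
    have [cy Ut] := yc t tt tD.
    have [|r r0 H] := @near_graph_stable (within `[t0, t1] (nbhs t)) t e (y0 t) _ _ (xc t tt) cy Ut e0.
      exact: cvg_within.
    exists r => //; move: H; rewrite near_withinE; apply: filterS => s Hs st _.
    by apply: Hs; rewrite /= in_itv.
  have [l [r [yl yr Ul Ur]]] := yD t tD; have /andP[t0t tt1] := Dt t tD.
  have xt : {for t, continuous x0}.
    have tint : interior [set` `[t0, t1]] t.
      rewrite /interior/=; near=> s; rewrite /= in_itv/=.
      by apply/andP; split; apply: ltW; near: s; [exact: lt_nbhsr|exact: lt_nbhsl].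
    by have := xc t tt; rewrite within_interior.
  have [||r1 r10 H1] := @near_graph_stable (t^'-) t e l _ _ _ yl Ul e0.
  - exact: cvg_within.
  - exact: cvg_at_left_filter.
  have [||r2 r20 H2] := @near_graph_stable (t^'+) t e r _ _ _ yr Ur e0.
  - exact: cvg_within.
  - exact: cvg_at_right_filter.
  have m0 : 0 < Num.min r1 r2 by rewrite lt_min r10.
  exists (Num.min r1 r2) => //; apply: near_split.
  - by apply: filterS H1 => s Hs _ _; apply: graph_stable_le Hs => //; rewrite ge_min lexx.
  - by rewrite tD.
  - by apply: filterS H2 => s Hs _ _; apply: graph_stable_le Hs => //; rewrite ge_min lexx orbT.
have [r [r0 Hr]] : exists r, 0 < r /\ [set` `[t0, t1]] `<=`
    (fun s => t0 <= s <= t1 -> s \notin D -> graph_stable e r s).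
  apply: (@filter_ex _ (0^'+)); near=> r; split; near: r => //.
  exact: nbhs_right_gt.
by exists r => // s st sD; apply: Hr => //; rewrite /= in_itv.
Unshelve. all: by end_near. Qed.

End graph_neighborhood.

(** * Functions modified on a finite set *)

Section off_finite_set.
Variable R : realType.
Local Notation mu := (@lebesgue_measure R).

Lemma measurable_fun_eq_off_seq (c d : R) (D : seq R) (f g : R -> R) :
  measurable_fun `[c, d] g ->
  (forall s, c <= s <= d -> s \notin D -> f s = g s) ->
  measurable_fun `[c, d] f.
Proof.
move=> mg fg; set A : set R := `[c, d] `\` [set` D].
have mA : measurable A by apply: measurableD => //; exact: measurable_seq.
have mB : measurable (`[c, d] `&` [set` D] : set R).
  by apply: measurableI => //; exact: measurable_seq.
have E : [set` `[c, d]] = A `|` (`[c, d] `&` [set` D]).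
  by rewrite /A setDE -setIUr setUC setUv setIT.
rewrite E; apply/measurable_funU => //; split.
  apply: (eq_measurable_fun g).
    by move=> s; rewrite inE => -[/= + /negP sD]; rewrite in_itv/= => scd; rewrite fg.
  by apply: measurable_funS mg => // s [].
move=> _ Y mY; apply: countable_measurable; first by move=> t; exact: measurable_set1.
by apply: finite_set_countable; apply: finite_setIl; apply: finite_setIr; exact: finite_seq.
Qed.

Lemma Rintegral_eq_off_seq (c d : R) (D : seq R) (f g : R -> R) :
  measurable_fun `[c, d] g ->
  (forall s, c <= s <= d -> s \notin D -> f s = g s) ->
  \int[mu]_(s in `[c, d]) f s = \int[mu]_(s in `[c, d]) g s.
Proof.
move=> mg fg; have mf := measurable_fun_eq_off_seq mg fg.
congr fine; apply: ae_eq_integral => //; [exact/measurable_EFinP..|].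
exists [set` D]; split; [exact: measurable_seq|exact: lebesgue_measure_seq|].
move=> s /= /not_implyP[]; rewrite in_itv/= => scd H.
by apply: contrapT => /negP sD; apply: H; rewrite fg.
Qed.

Lemma ae_le_off_seq (c d : R) (D : seq R) (f : R -> R) (M : R) : 0 <= M ->
  (forall s, c <= s <= d -> s \notin D -> f s <= M) ->
  (ess_sup mu ((fun t => (f t)%:E) \_ `[c, d]) <= M%:E)%E.
Proof.
move=> M0 fM; apply/ess_supP.
exists [set` D]; split; [exact: measurable_seq|exact: lebesgue_measure_seq|].
move=> s /= H; apply: contrapT => /negP sD; apply: H.
rewrite patchE; case: ifPn => [|_]; last by rewrite lee_fin.
by rewrite inE/= in_itv/= => scd; rewrite lee_fin fM.
Qed.

End off_finite_set.

(** * Piecewise continuity and fractional integrals of the perturbations *)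

Section perturbation.
Variables (R : realType) (n : nat).
Local Notation mu := (@lebesgue_measure R).
Implicit Types (f g : R -> 'rV[R]_n).

Lemma PC_side_limits (c d t : R) f : PC c d f -> c < t < d ->
  cvg (f s @[s --> t^'-]) /\ cvg (f s @[s --> t^'+]).
Proof.
move=> [D [Dcd fD fl]] /andP[ct td].
have [/fl//|tD] := boolP (t \in D).
have tcd : c <= t <= d by rewrite !ltW.
have ft := fD t tcd tD.
have near_cd : \forall s \near t, c <= s <= d.
  near=> s; apply/andP; split; apply: ltW; near: s; [exact: lt_nbhsr|exact: lt_nbhsl].
split; apply/cvg_ex; exists (f t); apply: cvg_trans ft; apply: cvg_app.
- move=> A; rewrite /at_left /within/=; apply: filterS2 near_cd => s scd + _.
  by apply; rewrite in_itv.
- move=> A; rewrite /at_right /within/=; apply: filterS2 near_cd => s scd + _.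
  by apply; rewrite in_itv.
Unshelve. all: by end_near. Qed.

Lemma PCD (c d : R) f g : PC c d f -> PC c d g -> PC c d (fun s => f s + g s).
Proof.
move=> [D1 [D1cd c1 l1]] [D2 [D2cd c2 l2]].
exists (D1 ++ D2); split.
- by move=> s; rewrite mem_cat => /orP[/D1cd|/D2cd].
- move=> s scd; rewrite mem_cat negb_or => /andP[s1 s2].
  by apply: cvgD; [exact: c1|exact: c2].
- move=> t tD; have tcd : c < t < d.
    by move: tD; rewrite mem_cat => /orP[/D1cd|/D2cd].
  have [fl fr] : cvg (f s @[s --> t^'-]) /\ cvg (f s @[s --> t^'+]).
    by apply: PC_side_limits tcd; exists D1.
  have [gl gr] : cvg (g s @[s --> t^'-]) /\ cvg (g s @[s --> t^'+]).
    by apply: PC_side_limits tcd; exists D2.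
  have sum (F : set_system R) : Filter F -> cvg (f s @[s --> F]) ->
      cvg (g s @[s --> F]) -> cvg (f s + g s @[s --> F]).
    move=> FF /cvg_ex[/= u fu] /cvg_ex[/= v gv].
    by apply/cvg_ex; exists (u + v); exact: cvgD.
  by split; [exact: (sum (t^'-) _ fl gl)|exact: (sum (t^'+) _ fr gr)].
Qed.

Lemma PCZ (c d k : R) f : PC c d f -> PC c d (fun s => k *: f s).
Proof.
move=> [D [Dcd fD fl]]; exists D; split; first exact: Dcd.
  by move=> t tcd tD; apply: cvgZl_tmp; exact: fD.
move=> t tD; have [/cvg_ex[/= u fu] /cvg_ex[/= v fv]] := fl t tD.
split; apply/cvg_ex; [exists (k *: u)|exists (k *: v)]; exact: cvgZl_tmp.
Qed.

(** As r vanishes from q < d on, the weight acts only where d - s > 0, and there it is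
    continuous. *)
Lemma PC_weighted_jumps (c d a : R) (r : R -> R) (z : 'rV[R]_n) (q : R) :
  c < d -> q < d -> jumps_in c d r -> (forall s, q <= s -> r s = 0) ->
  PC c d (fun s => ((d - s) `^ a * r s) *: z).
Proof.
move=> cd qd [D [Dcd rD rl]] r0.
have wc s : s < d -> {for s, continuous (fun s => (d - s) `^ a)}.
  move=> sd; apply: (@continuous_comp _ _ _ (fun s => d - s) (fun u => u `^ a)).
    by apply: cvgB; [exact: cvg_cst|exact: cvg_id].
  apply: differentiable_continuous; apply/derivable1_diffP.
  by apply: derivable_powR; rewrite in_itv/= andbT subr_gt0.
exists D; split=> // s.
- move=> /andP[cs sd] sD; apply: cvg_within_filter; apply: cvgZr_tmp.
  have [sltd|] := ltP s d; first by apply: cvgM; [exact: wc|exact: rD].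
  move=> ds; have -> : s = d by apply/eqP; rewrite eq_le sd.
  rewrite r0 ?mulr0; last exact: ltW.
  apply: cvg_near_cst; near=> u; rewrite r0 ?mulr0//; apply: ltW.
  by near: u; exact: lt_nbhsr.
- move=> sD; have /andP[cs sd] := Dcd s sD; have [rll rlr] := rl s.
  have wl : cvg ((d - u) `^ a @[u --> s^'-]).
    by apply/cvg_ex; exists ((d - s) `^ a); apply: cvg_at_left_filter; exact: wc.
  have wr : cvg ((d - u) `^ a @[u --> s^'+]).
    by apply/cvg_ex; exists ((d - s) `^ a); apply: cvg_at_right_filter; exact: wc.
  by split; apply: is_cvgZr_tmp; apply: is_cvgM.
Unshelve. all: by end_near. Qed.

Lemma frac_intD (a c d : R) f g t : 0 < a -> PC c d f -> PC c d g -> c <= t <= d ->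
  frac_int a c (fun s => f s + g s) t = frac_int a c f t + frac_int a c g t.
Proof.
move=> a0 PCf PCg /andP[ct td]; apply/rowP => i; rewrite [RHS]mxE !frac_intE -mulrDr.
have bt h : PC c d h -> bounded_measurable c t (fun s => h s 0 i).
  by move=> PCh; apply: bounded_measurable_subset (PC_coord_bounded_measurable i PCh).
rewrite -RintegralD//; [|exact: integrable_kernel (lexx t) (bt _ _)..].
by congr (_ * _); apply: eq_Rintegral => s _; rewrite mxE mulrDr.
Qed.

End perturbation.

Section variation.
Variables (R : realType) (n : nat).
Local Notation mu := (@lebesgue_measure R).

Lemma frac_int_wave (a t0 t1 k t : R) (r : R -> R) (z : 'rV[R]_n) :
  0 < a <= 1 -> t0 < t1 -> bounded_measurable t0 t1 r -> t0 <= t <= t1 ->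
  frac_int a t0 (fun s => k *: (((t1 - s) `^ (1 - a) * r s) *: z)) t =
  ((Gamma a)^-1 * k *
   \int[mu]_(s in `[t0, t]) ((t - s) `^ (a - 1) * ((t1 - s) `^ (1 - a) * r s)))
    *: z.
Proof.
move=> a01 t01 br tt; apply/rowP => i; rewrite frac_intE mxE.
have /andP[t0t tt1] := tt; have /andP[a0 a1] := a01.
rewrite -(mulrA _ k) -mulrA; congr (_ * _); rewrite mulrAC -RintegralZl//.
  by apply: eq_Rintegral => s _; rewrite !mxE; ring.
apply: (integrable_kernel (f := fun s => (t1 - s) `^ (1 - a) * r s)) => //.
apply: bounded_measurableM; last exact: bounded_measurable_subset br.
split; first exact: measurable_fun_powRB.
exists ((t1 - t0) `^ (1 - a)) => s st; rewrite ger0_norm ?powR_ge0//.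
by apply: ge0_ler_powR; rewrite ?nnegrE; lra.
Qed.

Lemma norm_PCalpha_le (a t0 t1 e1 e2 : R) (D : seq R) (h : R -> 'rV[R]_n) :
  t0 < t1 -> 0 <= e2 -> (forall t, t0 <= t <= t1 -> `|h t| <= e1) ->
  (forall t, t0 <= t <= t1 -> t \notin D -> `|caputo a t0 t1 h t| <= e2) ->
  (norm_PCalpha a t0 t1 h <= (n%:R * e1 + n%:R * e2)%:E)%E.
Proof.
move=> t01 e20 he1 he2; rewrite /norm_PCalpha EFinD; apply: leeD.
  rewrite lee_fin; apply: ge_sup.
    by exists (enorm (h t0)); exists t0 => //=; rewrite in_itv/= lexx ltW.
  move=> _ [t /= + <-]; rewrite in_itv/= => tt.
  by apply: (le_trans (enorm_le _)); rewrite ler_wpM2l// he1.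
apply: (@ae_le_off_seq R t0 t1 D); first by rewrite mulr_ge0.
by move=> s st sD; apply: (le_trans (enorm_le _)); rewrite ler_wpM2l// he2.
Qed.

End variation.

Lemma quarter_sum (R : realType) (x y d : R) : 0 < d -> x <= d / 4 ->
  y < d / 4 -> x + 2 * y < d.
Proof. lra. Qed.

Lemma increment_estimate (R : realType) (c g l0 l1 e : R) :
  `|g - l0| < e / 2 -> `|c + g - l1| < e / 2 -> `|l1 - l0 - c| <= e.
Proof.
move=> g0 g1; have -> : l1 - l0 - c = (g - l0) - (c + g - l1) by ring.
by rewrite (le_trans (ler_normB _ _))// (splitr e) lerD// ltW.
Qed.

(** The increments c for r = 1 and d for r = -1 become two values of one affine function of r, whose
    odd part disappears on integration because the wave has integral 0. *)
Lemma half_sum (R : realType) (c d e : R) : c + d = - 4 * e ->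
  c = - 2 * e + (c - d) / 2 /\ d = - 2 * e - (c - d) / 2.
Proof. lra. Qed.

(** * The competitor and the decrease of J *)

Section weak_minimum.
Variables (R : realType) (n : nat) (t0 t1 a b : R).
Variables (L : R -> 'rV[R]_n -> 'rV[R]_n -> R) (x0 psi y0 : R -> 'rV[R]_n).
Variables (U : set (R * 'rV[R]_n * 'rV[R]_n)) (D : seq R) (K delta : R).
Local Notation mu := (@lebesgue_measure R).
Hypotheses (t01 : t0 < t1) (a01 : 0 < a <= 1) (b_gt0 : 0 < b).
Hypotheses (oU : open U) (LU : forall p, U p ->
  {for p, continuous (fun q : R * 'rV[R]_n * 'rV[R]_n => L q.1.1 q.1.2 q.2)}).
Hypothesis x0_cont : {within `[t0, t1], continuous x0}.
Hypotheses (psi_PC : PC t0 t1 psi)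
  (x0E : forall t, t0 <= t <= t1 -> x0 t = x0 t0 + frac_int a t0 psi t).
Hypotheses (K_neq0 : K != 0) (caputoE : forall phi f : R -> 'rV[R]_n,
  PC t0 t1 f ->
  (forall t, t0 <= t <= t1 -> phi t = phi t0 + frac_int a t0 f t) ->
  forall t, t0 <= t <= t1 -> cont_at_in t0 t1 f t ->
  caputo a t0 t1 phi t = K *: f t).
Hypotheses (D_in : forall t, t \in D -> t0 < t < t1)
  (psi_cont : forall t, t0 <= t <= t1 -> t \notin D -> cont_at_in t0 t1 psi t)
  (y0E : forall t, y0 t = K *: psi t)
  (y0_in : forall t, t0 <= t <= t1 -> t \notin D ->
     cont_at_in t0 t1 y0 t /\ U (t, x0 t, y0 t))
  (y0_lim : forall t, t \in D -> exists l r, [/\ y0 s @[s --> t^'-] --> l,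
     y0 s @[s --> t^'+] --> r, U (t, x0 t, l) & U (t, x0 t, r)]).
Hypotheses (delta_gt0 : 0 < delta) (x0_min : forall x : R -> 'rV[R]_n,
  admissible a t0 t1 (x0 t0) (x0 t1) x ->
  (norm_PCalpha a t0 t1 (fun t => x t - x0 t)%R < delta%:E)%E ->
  functionalJ a b t0 t1 L x0 <= functionalJ a b t0 t1 L x).

Let weight (s : R) : R := (t1 - s) `^ (b - 1).

Let integrable_weight : mu.-integrable `[t0, t1] (EFin \o weight).
Proof. exact: integrable_powRB. Qed.

Let near_interior t : t0 < t < t1 -> \forall s \near t, t0 < s < t1.
Proof.
move=> /andP[t0t tt1]; near=> s; apply/andP; split; near: s.
  exact: lt_nbhsr.
exact: lt_nbhsl.
Unshelve. all: by end_near. Qed.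

Let cont_in_interior (f : R -> 'rV[R]_n) t : t0 < t < t1 -> cont_at_in t0 t1 f t ->
  {for t, continuous f}.
Proof.
move=> tt; rewrite /cont_at_in within_interior//.
rewrite /interior/=; apply: filterS (near_interior tt) => s /andP[/ltW s0 /ltW s1].
by rewrite /= in_itv/= s0.
Qed.

Let measurable_graph (X Y : R -> 'rV[R]_n) (D' : seq R) :
  (forall t, t0 <= t <= t1 -> t \notin D' ->
    [/\ cont_at_in t0 t1 X t, cont_at_in t0 t1 Y t & U (t, X t, Y t)]) ->
  measurable_fun `[t0, t1] (fun s => L s (X s) (Y s)).
Proof.
move=> H; apply: (@measurable_fun_off_seq _ t0 t1 D') => t tt tD.
have [cX cY Ut] := H t tt tD.
apply/cvgrPdist_lt => e e0.
have [r r0 rP] := near_uniform oU LU Ut e0.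
have ct : s @[s --> within `[t0, t1] (nbhs t)] --> t by exact: cvg_within.
move/cvgrPdist_lt : ct => /(_ _ r0) ct; move/cvgrPdist_lt : cX => /(_ _ r0) cX.
move/cvgrPdist_lt : cY => /(_ _ r0) cY.
by apply: filterS3 ct cX cY => s ts Xs Ys; have [] := rP s (X s) (Y s) ts Xs Ys.
Qed.

Lemma second_difference_ge0 (t : R) (xi : 'rV[R]_n) : t0 < t < t1 ->
  t \notin D -> n%:R * `|xi| < delta / 4 ->
  U (t, x0 t, y0 t + xi) -> U (t, x0 t, y0 t - xi) ->
  0 <= L t (x0 t) (y0 t + xi) + L t (x0 t) (y0 t - xi) - 2 * L t (x0 t) (y0 t).
Proof.
move=> tt tD xid Up Um; rewrite leNgt; apply/negP => neg.
have /andP[t0t tt1] := tt; have tt' : t0 <= t <= t1 by rewrite !ltW.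
have /andP[a0 a1] := a01.
have [y0t U0] := y0_in tt' tD.
pose Lam s x y := weight s * L s x y.
(* Cutting [U] at s < t1 makes the weight continuous, as it may be singular at t1. *)
pose U' := U `&` [set p | p.1.1 < t1].
have oU' : open U'.
  apply: openI => //; apply: (@open_comp _ _ (fun p : R * 'rV[R]_n * 'rV[R]_n => p.1.1) [set u | u < t1]) => //.
  by move=> p _; apply: (@continuous_comp _ _ _ fst fst); exact: cvg_fst.
have LamU' p : U' p -> {for p, continuous
    (fun q : R * 'rV[R]_n * 'rV[R]_n => Lam q.1.1 q.1.2 q.2)}.
  move=> [/LU Lp] /= pt1; apply: cvgM; last exact: Lp.
  apply: (@continuous_comp _ _ _ (fun q : R * 'rV[R]_n * 'rV[R]_n => q.1.1) weight).
    by apply: (@continuous_comp _ _ _ fst fst); exact: cvg_fst.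
  apply: (@continuous_comp _ _ _ (fun s => t1 - s) (fun u => u `^ (b - 1))).
    by apply: cvgB; [exact: cvg_cst|exact: cvg_id].
  apply: differentiable_continuous; apply/derivable1_diffP.
  by apply: derivable_powR; rewrite in_itv/= andbT subr_gt0.
have wt0 : 0 < weight t by rewrite powR_gt0// subr_gt0.
(* The weighted second difference is -4 eta. The mean increment over the two phases is then -2 eta,
   and two errors of eta / 2 still leave -eta. *)
pose eta := - (weight t * (L t (x0 t) (y0 t + xi) + L t (x0 t) (y0 t - xi)
  - 2 * L t (x0 t) (y0 t))) / 4.
have eta0 : 0 < eta by rewrite /eta divr_gt0// oppr_gt0 pmulr_rlt0.
have eta20 : 0 < eta / 2 by rewrite divr_gt0.
have [r1 r10 P1] := near_uniform oU' LamU' (p := (t, x0 t, y0 t + xi)) (conj Up tt1) eta20.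
have [r2 r20 P2] := near_uniform oU' LamU' (p := (t, x0 t, y0 t - xi)) (conj Um tt1) eta20.
have [r3 r30 P3] := near_uniform oU' LamU' (p := (t, x0 t, y0 t)) (conj U0 tt1) eta20.
pose rho := Num.min r1 (Num.min r2 r3).
have rho0 : 0 < rho by rewrite !lt_min r10 r20.
have rr1 : rho <= r1 by rewrite ge_min lexx.
have rr2 : rho <= r2 by rewrite !ge_min lexx orbT.
have rr3 : rho <= r3 by rewrite !ge_min lexx !orbT.
pose w s := (t1 - s) `^ (1 - a).
have wt_gt0 : 0 < w t by rewrite powR_gt0// subr_gt0.
have cw : {for t, continuous w}.
  apply: (@continuous_comp _ _ _ (fun s => t1 - s) (fun u => u `^ (1 - a))).
    by apply: cvgB; [exact: cvg_cst|exact: cvg_id].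
  apply: differentiable_continuous; apply/derivable1_diffP.
  by apply: derivable_powR; rewrite in_itv/= andbT subr_gt0.
have cwx : w s / w t *: xi @[s --> t] --> xi.
  rewrite -[X in _ --> X]scale1r -(@divff _ (w t)) ?gt_eqF//.
  by apply: cvgZr_tmp; apply: cvgM; [exact: cw|exact: cvg_cst].
(* Near t the ratio is at most 2, so |v| <= 2 |xi|: with n |xi| < delta / 4 the derivative takes
   less than delta / 2 of the norm, and the state will take at most delta / 4. *)
have cw2 : w s / w t @[s --> t] --> (1 : R).
  rewrite -(@divff _ (w t)) ?gt_eqF//.
  by apply: cvgM; [exact: cw|exact: cvg_cst].
have rho20 : 0 < rho / 2 by rewrite divr_gt0.
have : \forall s \near t, [/\ t0 < s < t1, s \notin D, `|t - s| < rho &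
    [/\ `|x0 t - x0 s| < rho / 2, `|y0 t - y0 s| < rho / 2,
        `|xi - w s / w t *: xi| < rho / 2 & w s / w t <= 2]].
  near=> s; split.
  - by near: s; exact: near_interior.
  - by near: s; exact: near_notin.
  - by near: s; exact: cvgr_dist_lt.
  split.
  - near: s; have /subspace_continuousP/(_ t) := x0_cont.
    rewrite /= in_itv/= => /(_ tt') /(cont_in_interior tt) H.
    by move/cvgrPdist_lt : H; exact.
  - by near: s; have /cvgrPdist_lt := cont_in_interior tt y0t; exact.
  - by near: s; move/cvgrPdist_lt : cwx; exact.
  - have : `|1 - w s / w t| < 1 by near: s; move/cvgrPdist_lt : cw2; exact.
    by rewrite distrC => /ltr_distlDr/ltW.
move=> /nbhs_ballP[r4 /= r40 B4].
pose p := t - r4 / 2; pose q := t + r4 / 2.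
have hr4 : 0 < r4 / 2 by rewrite divr_gt0.
have pq : p < q by apply: (@lt_trans _ _ t); rewrite ?ltrBlDr ltrDl.
have Bpq s : p <= s <= q -> [/\ t0 < s < t1, s \notin D, `|t - s| < rho &
    [/\ `|x0 t - x0 s| < rho / 2, `|y0 t - y0 s| < rho / 2,
        `|xi - w s / w t *: xi| < rho / 2 & w s / w t <= 2]].
  move=> /andP[ps sq]; apply: B4; rewrite /ball/= distrC.
  apply: (@le_lt_trans _ _ (r4 / 2)); last by rewrite ltr_pdivrMr// ltr_pMr// ltr1n.
  by rewrite ler_distl ps.
have [/andP[t0p _] _ _ _] := Bpq p ltac:(by rewrite lexx ltW).
have [/andP[_ qt1] _ _ _] := Bpq q ltac:(by rewrite lexx ltW).
pose zeta := (w t)^-1 *: xi.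
pose W0 := \int[mu]_(s in `[t0, t1]) weight s.
have W00 : 0 < W0.
  rewrite /W0 Rintegral_powRB ?(ltW t01)// subrr powR0 ?gt_eqF// subr0.
  by rewrite divr_gt0// powR_gt0// subr_gt0.
(* With this eps the total loss eps * W0 is half of the gain eta (q - p). *)
pose eps := (q - p) * eta / (2 * W0).
have qp0 : 0 < q - p by rewrite subr_gt0.
have eps0 : 0 < eps by apply: divr_gt0; exact: mulr_gt0.
have [rg rg0 stab] := graph_uniform oU LU t01 x0_cont D_in y0_in y0_lim eps0.
have n10 : 0 < 4 * (n%:R + 1) :> R by rewrite mulr_gt0// ltr_wpDl.
(* The three terms keep x0 + h in the tube, in the box around t, and within a share delta / 4 of the
   norm; n + 1 because n may be 0. *)
pose sigma := Num.min (rg / 2) (Num.min (rho / 2) (delta / (4 * (n%:R + 1)))).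
have sigma0 : 0 < sigma by rewrite !lt_min !divr_gt0.
have sigma_rg : sigma < rg.
  apply: (@le_lt_trans _ _ (rg / 2)); first by rewrite ge_min lexx.
  by rewrite ltr_pdivrMr// ltr_pMr// ltr1n.
have sigma_rho : sigma <= rho / 2 by rewrite !ge_min lexx orbT.
have sigma_delta : n%:R * sigma <= delta / 4.
  have : sigma <= delta / (4 * (n%:R + 1)) by rewrite !ge_min lexx !orbT.
  rewrite ler_pdivlMr// ler_pdivlMr// => H; apply: le_trans H.
  have -> : sigma * (4 * (n%:R + 1)) = n%:R * sigma * 4 + 4 * sigma by ring.
  by rewrite lerDl mulr_ge0// ltW.
pose C := `|(Gamma a)^-1 * K^-1| * `|zeta| + 1.
have C0 : 0 < C by rewrite ltr_wpDl// mulr_ge0.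
have sC0 : 0 < sigma / C by rewrite divr_gt0.
have [r [rJ r_out r_in rint rw]] := square_wave_exists a01 t0p pq qt1 sC0.
have r_le1 s : `|r s| <= 1.
  have [/r_in[]->|/r_out->] := boolP (p <= s < q); by rewrite ?normrN ?normr1 ?normr0.
have br := bounded_measurable_jumps_in rJ r_le1.
pose v s := (w s * r s) *: zeta.
pose h := frac_int a t0 (fun s => K^-1 *: v s).
have hE s : t0 <= s <= t1 -> h s = ((Gamma a)^-1 * K^-1 *
    \int[mu]_(u in `[t0, s]) ((s - u) `^ (a - 1) * ((t1 - u) `^ (1 - a) * r u))) *: zeta.
  by move=> st; rewrite /h frac_int_wave.
have h_le s : t0 <= s <= t1 -> `|h s| <= sigma.
  move=> st; rewrite hE// normrZ normrM mulrAC.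
  apply: (@le_trans _ _ (C * (sigma / C))); last by rewrite mulrCA divff ?gt_eqF// mulr1.
  by apply: ler_pM; rewrite ?mulr_ge0 ?lerDl//; exact: rw.
have ht1 : h t1 = 0.
  rewrite hE ?(ltW t01) ?lexx// (_ : Rintegral _ _ _ = 0) ?mulr0 ?scale0r//.
  rewrite -[RHS]rint; apply: eq_Rintegral => u; rewrite inE/= in_itv/= => /andP[t0u].
  (* For u < t1 the kernel and the weight cancel, leaving the integral of r. At u = t1 they do not
     cancel when a < 1, a negative power of 0 being 0, but r vanishes there. *)
  rewrite le_eqVlt => /predU1P[->|ut1]; first by rewrite r_out ?mulr0// negb_and -!leNgt (ltW qt1) orbT.
  rewrite mulrA -powRD; last by rewrite subr_eq0 (gt_eqF ut1) implybT.
  by rewrite (_ : a - 1 + (1 - a) = 0) ?powRr0 ?mul1r//; ring.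
have ht0 : h t0 = 0 by exact: frac_int_t0.
have PCv : PC t0 t1 v.
  apply: (@PC_weighted_jumps R n t0 t1 (1 - a) r zeta q) => // s qs.
  by apply: r_out; rewrite negb_and -!leNgt qs orbT.
have PCkv := PCZ K^-1 PCv.
pose x s := x0 s + h s.
pose psi' s := psi s + K^-1 *: v s.
have PCpsi' : PC t0 t1 psi' by exact: PCD.
have xE s : t0 <= s <= t1 -> x s = x t0 + frac_int a t0 psi' s.
  move=> st; have -> : x t0 = x0 t0 by rewrite /x ht0 addr0.
  by rewrite /x (x0E st) -addrA (frac_intD a0 psi_PC PCkv st).
have adm : admissible a t0 t1 (x0 t0) (x0 t1) x.
  split; [|by rewrite /x ht0 addr0|by rewrite /x ht1 addr0].
  split; last by exists psi'.
  apply/subspace_continuousP => s st; apply: cvgD.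
    by move/subspace_continuousP : x0_cont; exact.
  by have /subspace_continuousP := frac_int_continuous a01 PCkv; exact.
have [Dv [Dv_in v_cont v_lim]] := PCv.
have cap_x s : t0 <= s <= t1 -> s \notin D ++ Dv -> caputo a t0 t1 x s = y0 s + v s.
  rewrite mem_cat negb_or => st /andP[sD sDv].
  rewrite (caputoE PCpsi' xE st); last first.
    by apply: cvgD; [exact: psi_cont|apply: cvgZl_tmp; exact: v_cont].
  by rewrite scalerDr scalerA divff// scale1r y0E.
have cap_h s : t0 <= s <= t1 -> s \notin Dv -> caputo a t0 t1 h s = v s.
  move=> st sDv; rewrite (caputoE PCkv _ st).
  - by rewrite scalerA divff// scale1r.
  - by move=> u _; rewrite ht0 add0r.
  - by apply: cvgZl_tmp; exact: v_cont.
have cap_x0 s : t0 <= s <= t1 -> s \notin D -> caputo a t0 t1 x0 s = y0 s.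
  by move=> st sD; rewrite (caputoE psi_PC x0E st) ?y0E//; exact: psi_cont.
have vE s : v s = (r s * (w s / w t)) *: xi.
  by rewrite /v /zeta scalerA mulrAC [_ * r s]mulrC.
have v_le s : t0 <= s <= t1 -> `|v s| <= 2 * `|xi|.
  move=> st; rewrite vE normrZ ler_wpM2r// normrM.
  have [spq|/r_out->] := boolP (p <= s < q); last by rewrite normr0 mul0r.
  have [|_ _ _ [_ _ _ ws]] := Bpq s; first by move: spq => /andP[-> /ltW].
  rewrite -[2]mul1r; apply: ler_pM => //.
  by rewrite ger0_norm// divr_ge0 ?powR_ge0.
have normx : (norm_PCalpha a t0 t1 (fun s => (x s - x0 s)%R) < delta%:E)%E.
  have -> : (fun s => x s - x0 s) = h.
    by apply/funext => s; rewrite /x addrAC subrr add0r.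
  apply: (@le_lt_trans _ _ (n%:R * sigma + n%:R * (2 * `|xi|))%:E).
    apply: (norm_PCalpha_le (D := Dv)) => //.
    by move=> s st sDv; rewrite cap_h// v_le.
  rewrite lte_fin (_ : n%:R * (2 * `|xi|) = 2 * (n%:R * `|xi|)); last by ring.
  by apply: quarter_sum.
have := x0_min adm normx; apply/negP; rewrite -ltNge -subr_lt0.
pose D' := D ++ Dv.
(* At the exceptional points the Caputo derivative may be arbitrary and L uncontrolled; 0 is put in
   instead, which changes no integral. *)
pose F0 s := weight s * (if s \in D' then 0 else L s (x0 s) (y0 s)).
pose F1 s := weight s * (if s \in D' then 0 else L s (x s) (y0 s + v s)).
pose cp := Lam t (x0 t) (y0 t + xi) - Lam t (x0 t) (y0 t).
pose cm := Lam t (x0 t) (y0 t - xi) - Lam t (x0 t) (y0 t).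
have [cpE cmE] : cp = - 2 * eta + (cp - cm) / 2 /\ cm = - 2 * eta - (cp - cm) / 2.
  by apply: half_sum; rewrite /cp /cm /eta /Lam; field.
(* on [p, q[ the weighted increment is at most (cp + cm) / 2 + eta +
   r (cp - cm) / 2 = - eta + r (cp - cm) / 2, and r integrates to 0 *)
pose bound s := - eta * cell p (q - p) s + (cp - cm) / 2 * r s + eps * weight s.
have weight0 s : 0 <= weight s by exact: powR_ge0.
have key s : t0 <= s <= t1 -> s \notin D' -> [/\ U (s, x s, y0 s + v s),
    F1 s - F0 s <= bound s &
    `|F1 s - F0 s| <= `|cp| + `|cm| + eta + eps * weight s].
  move=> st sD'; rewrite /F0 /F1 (negbTE sD') -mulrBr.
  have [sD sDv] : s \notin D /\ s \notin Dv.
    by move: sD'; rewrite mem_cat negb_or => /andP.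
  have hs : `|h s| <= sigma by exact: h_le.
  have [spq|spq] := boolP (p <= s < q); last first.
    (* Outside [p, q[ the derivative is unchanged; only the shift of the state counts, and the tube
       bounds its effect by eps times the weight. *)
    have [U1 E1 _] := stab s st sD (h s) (le_lt_trans hs sigma_rg).
    rewrite /bound vE r_out// mul0r scale0r addr0 mulr0 addr0.
    have -> : cell p (q - p) s = 0 by rewrite /cell addrC subrK (negbTE spq).
    rewrite mulr0 add0r.
    have E2 : `|weight s * (L s (x s) (y0 s) - L s (x0 s) (y0 s))| <= eps * weight s.
      by rewrite normrM ger0_norm// mulrC ler_wpM2r.
    split=> //; first exact: le_trans (ler_norm _) E2.
    by apply: (le_trans E2); rewrite lerDr !addr_ge0// ltW.
  have [|_ _ ts [xs ys xis _]] := Bpq s; first by move: spq => /andP[-> /ltW].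
  have xxs : `|x0 t - x s| < rho.
    rewrite /x opprD addrA (le_lt_trans (ler_normB _ _))//.
    by rewrite (splitr rho) ltr_leD// (le_trans hs).
  have x0s : `|x0 t - x0 s| < rho by rewrite (lt_trans xs)// ltr_pdivrMr// ltr_pMr// ltr1n.
  have y0s : `|y0 t - y0 s| < rho by rewrite (lt_trans ys)// ltr_pdivrMr// ltr_pMr// ltr1n.
  have [_ /= E0] := P3 s (x0 s) (y0 s) (lt_le_trans ts rr3) (lt_le_trans x0s rr3)
    (lt_le_trans y0s rr3).
  have cellE : cell p (q - p) s = 1 by rewrite /cell addrC subrK spq.
  have ew : 0 <= eps * weight s by rewrite mulr_ge0// ltW.
  (* One argument for the two phases: [sg] is the value of the wave and [c] the increment at t for
     that phase. *)
  have finish (c sg : R) : `|c + Lam t (x0 t) (y0 t) - Lam s (x s) (y0 s + v s)| < eta / 2 ->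
      c <= - 2 * eta + sg * ((cp - cm) / 2) -> `|c| <= `|cp| + `|cm| -> r s = sg ->
      weight s * (L s (x s) (y0 s + v s) - L s (x0 s) (y0 s)) <= bound s /\
      `|weight s * (L s (x s) (y0 s + v s) - L s (x0 s) (y0 s))| <=
        `|cp| + `|cm| + eta + eps * weight s.
    move=> Ec cle cabs rs; rewrite mulrBr -!/(Lam _ _ _).
    have E3 := increment_estimate E0 Ec; split.
      have := le_trans (ler_norm _) E3; rewrite lerBlDr => /le_trans; apply.
      apply: (@le_trans _ _ (eta + (- 2 * eta + sg * ((cp - cm) / 2)))).
        by rewrite lerD2l.
      rewrite /bound cellE rs; have -> : eta + (- 2 * eta + sg * ((cp - cm) / 2)) =
        - eta * 1 + (cp - cm) / 2 * sg by ring.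
      by rewrite lerDl.
    rewrite -[X in `|X|](subrK c); apply: (le_trans (ler_normD _ _)).
    by rewrite [leLHS]addrC ler_wpDr// lerD.
  have [rs|rs] := r_in s spq.
    have yvs : `|y0 t + xi - (y0 s + v s)| < rho.
      rewrite opprD addrACA (le_lt_trans (ler_normD _ _))//.
      by rewrite (splitr rho) ltrD// vE rs mul1r.
    have [/= [U1 _] E1] := P1 s (x s) (y0 s + v s) (lt_le_trans ts rr1)
      (lt_le_trans xxs rr1) (lt_le_trans yvs rr1).
    have [||||B1 B2] := finish cp 1 => //.
    - by rewrite /cp subrK.
    - by rewrite mul1r -cpE.
    - by rewrite lerDl.
  have yvs : `|y0 t - xi - (y0 s + v s)| < rho.
    rewrite opprD addrACA (le_lt_trans (ler_normD _ _))//.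
    rewrite (splitr rho) ltrD// vE rs mulN1r scaleNr opprK.
    by rewrite addrC -opprB normrN.
  have [/= [U1 _] E1] := P2 s (x s) (y0 s + v s) (lt_le_trans ts rr2)
    (lt_le_trans xxs rr2) (lt_le_trans yvs rr2).
  have [||||B1 B2] := finish cm (-1) => //.
  - by rewrite /cm subrK.
  - by rewrite mulN1r -cmE.
  - by rewrite lerDr.
have mweight : measurable_fun `[t0, t1] weight by exact: measurable_fun_powRB.
have mF0 : measurable_fun `[t0, t1] F0.
  apply: (@measurable_fun_eq_off_seq R t0 t1 D' _
    (fun s => weight s * L s (x0 s) (y0 s))).
    apply: measurable_realfun.measurable_funM => //.
    apply: (@measurable_graph x0 y0 D) => s st sD.
    have [cy Us] := y0_in st sD; split=> //.
    by move/subspace_continuousP : x0_cont; apply; rewrite /= in_itv.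
  by move=> s _ sD'; rewrite /F0 (negbTE sD').
have mF1 : measurable_fun `[t0, t1] F1.
  apply: (@measurable_fun_eq_off_seq R t0 t1 D' _
    (fun s => weight s * L s (x s) (y0 s + v s))).
    apply: measurable_realfun.measurable_funM => //.
    apply: (@measurable_graph x (fun s => y0 s + v s) D') => s st sD'.
    have [Us _ _] := key s st sD'; split=> //.
      have [[xc _] _ _] := adm.
      by move/subspace_continuousP : xc; apply; rewrite /= in_itv.
    move: sD'; rewrite mem_cat negb_or => /andP[sD sDv].
    by apply: cvgD; [have [] := y0_in st sD|exact: v_cont].
  by move=> s _ sD'; rewrite /F1 (negbTE sD').
have weightZ k : mu.-integrable `[t0, t1] (EFin \o (fun s => k * weight s)).
  exact: integrableRZ.
(* The case z = 0 of [graph_stable] bounds L along x0 by 1 / rg, so the integrand is dominated by a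
   multiple of the integrable weight. *)
have F0_le s : t0 <= s <= t1 -> `|F0 s| <= rg^-1 * weight s.
  move=> st; rewrite /F0 normrM ger0_norm// mulrC ler_wpM2r//.
  case: ifPn => [_|sD']; first by rewrite normr0 invr_ge0 ltW.
  have sD : s \notin D by move: sD'; rewrite mem_cat negb_or => /andP[].
  by have [|_ _] := stab s st sD 0; rewrite ?normr0.
have iF0 : mu.-integrable `[t0, t1] (EFin \o F0).
  apply: (le_integrable _ _ _ (weightZ rg^-1)) => //; first exact/measurable_EFinP.
  move=> s; rewrite /= in_itv/= => st; rewrite lee_fin (le_trans (F0_le s st))//.
  exact: ler_norm.
pose M := `|cp| + `|cm| + eta.
have M0 : 0 <= M by rewrite !addr_ge0// ltW.
have bM : bounded_measurable t0 t1 (fun=> M).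
  by split; [exact: measurable_cst|exists `|M|].
have iM : mu.-integrable `[t0, t1] (EFin \o (fun s => M + (eps + rg^-1) * weight s)).
  by apply: integrableRD => //; exact: integrable_bounded_measurable.
have iF1 : mu.-integrable `[t0, t1] (EFin \o F1).
  apply: (le_integrable _ _ _ iM) => //; first exact/measurable_EFinP.
  move=> s; rewrite /= in_itv/= => st; rewrite lee_fin; apply: le_trans (ler_norm _).
  have [sD'|sD'] := boolP (s \in D').
    rewrite /F1 sD' mulr0 normr0 addr_ge0// mulr_ge0// addr_ge0 ?invr_ge0 ?ltW//.
  have [_ _ E1] := key s st sD'; rewrite -(subrK (F0 s) (F1 s)).
  rewrite (le_trans (ler_normD _ _))// mulrDl addrA lerD//; exact: F0_le.
have JE0 : functionalJ a b t0 t1 L x0 = \int[mu]_(s in `[t0, t1]) F0 s.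
  apply: (@Rintegral_eq_off_seq R t0 t1 D') => // s st sD'.
  rewrite /F0 (negbTE sD') cap_x0//.
  by move: sD'; rewrite mem_cat negb_or => /andP[].
have JE1 : functionalJ a b t0 t1 L x = \int[mu]_(s in `[t0, t1]) F1 s.
  apply: (@Rintegral_eq_off_seq R t0 t1 D') => // s st sD'.
  by rewrite /F1 (negbTE sD') cap_x.
(* Put to 0 at the exceptional points, like the difference of F1 and F0, so that the comparison
   holds at every point of the interval. *)
pose bound' s := if s \in D' then 0 else bound s.
have bcell : bounded_measurable t0 t1 (cell p (q - p)) by exact: bounded_measurable_cell.
have icell k : mu.-integrable `[t0, t1] (EFin \o (fun s => k * cell p (q - p) s)).
  by apply: integrable_bounded_measurable; exact: bounded_measurableZ.
have ir k : mu.-integrable `[t0, t1] (EFin \o (fun s => k * r s)).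
  by apply: integrable_bounded_measurable; exact: bounded_measurableZ.
have icr k k' : mu.-integrable `[t0, t1] (EFin \o (fun s => k * cell p (q - p) s + k' * r s)).
  exact: integrableRD.
have ibound : mu.-integrable `[t0, t1] (EFin \o bound).
  exact: integrableRD.
have mbound : measurable_fun `[t0, t1] bound.
  by apply/measurable_EFinP; exact: measurable_int ibound.
have bound'E s : t0 <= s <= t1 -> s \notin D' -> bound' s = bound s.
  by move=> _ /negbTE sD'; rewrite /bound' sD'.
have ibound' : mu.-integrable `[t0, t1] (EFin \o bound').
  apply: (le_integrable _ _ _ ibound) => //.
    by apply/measurable_EFinP; exact: measurable_fun_eq_off_seq bound'E.
  by move=> s _; rewrite lee_fin /bound'; case: ifP => // _; rewrite normr0.
have cell_int : \int[mu]_(s in `[t0, t1]) cell p (q - p) s = q - p.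
  have := Rintegral_cell t0 t1 p (q - p) (fun=> 1).
  under eq_Rintegral do rewrite mul1r.
  move=> ->; rewrite addrC subrK [_ `&` _](_ : _ = [set` `[p, q[]); last first.
    apply/seteqP; split=> [s []//|s /=]; rewrite !in_itv/= => /andP[ps sq].
    by rewrite ps sq (ltW (lt_le_trans t0p ps)) (ltW (lt_trans sq qt1)).
  by rewrite Rintegral_cst//= lebesgue_measure_itv/= lte_fin pq mul1r.
have bound_int : \int[mu]_(s in `[t0, t1]) bound s = - eta * (q - p) + eps * W0.
  rewrite RintegralD// RintegralD//.
  rewrite !RintegralZl//; [|exact: integrable_bounded_measurable..].
  by rewrite cell_int rint mulr0 addr0.
rewrite JE0 JE1 -RintegralB//.
apply: (@le_lt_trans _ _ (\int[mu]_(s in `[t0, t1]) bound' s)).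
  apply: le_Rintegral => //.
    exact: integrableRB.
  move=> s; rewrite /= in_itv/= => st; rewrite /bound'; case: ifPn => sD'.
    by rewrite /F1 /F0 sD' subrr.
  by have [] := key s st sD'.
rewrite (Rintegral_eq_off_seq mbound bound'E) bound_int.
rewrite (_ : eps * W0 = eta * (q - p) / 2); last by rewrite /eps; field; rewrite gt_eqF.
have qe0 : 0 < eta * (q - p) by exact: mulr_gt0.
rewrite mulNr [ltLHS]addrC subr_lt0.
by rewrite ltr_pdivrMr// ltr_pMr// ltr1n.
Unshelve. all: by end_near.
Qed.

End weak_minimum.

(** * Second-order expansion *)

Section second_order.
Variables (R : realType) (n : nat).
Implicit Types (f : 'rV[R]_n -> R) (y u : 'rV[R]_n).

Lemma derive_rV f y u : differentiable f y ->
  'D_u f y = \sum_(i < n) u 0 i * 'D_(delta_mx 0 i) f y.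
Proof.
move=> df; rewrite deriveE// {1}[u]row_sum_delta linear_sum/=.
by apply: eq_bigr => i _; rewrite linearZ/= deriveE.
Qed.

Lemma is_derive_line f y u (s : R) : differentiable f (y + s *: u) ->
  is_derive s (1 : R) (fun r => f (y + r *: u)) ('D_u f (y + s *: u)).
Proof.
move=> df; have E : (fun h : R => h^-1 *:
    (((fun r => f (y + r *: u)) \o shift s) (h *: 1) - f (y + s *: u))) =
    (fun h => h^-1 *: ((f \o shift (y + s *: u)) (h *: u) - f (y + s *: u))).
  apply/funext => h; congr (_ *: (f _ - _)).
  have -> : shift s (h *: (1 : R)) = h + s by rewrite /shift/= /GRing.scale/= mulr1.
  by rewrite scalerDl addrCA.
split; last by rewrite /derive E.
by rewrite /derivable E; exact: diff_derivable.
Qed.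

(** The gradient is differentiable at y only, so second derivatives elsewhere may fail to exist. The
    mean value theorem is therefore applied once, to phi(c) = f(y + c u) + f(y - c u): some phi'(c)
    is nonnegative. But phi'(c) = k(y + c u) - k(y - c u), with k the derivative of f along u, and
    differentiability of k at y makes this about 2 c q. *)
Lemma hessian_ge0 f y (r : R) u : 0 < r -> twice_differentiable f y ->
  (forall v, `|v| < r -> 0 <= f (y + v) + f (y - v) - 2 * f y) ->
  0 <= dotv (u *m (hessian f y)^T) u.
Proof.
move=> r0 [df dg] f2; pose g i z := 'D_(delta_mx 0 i) f z.
have dgi i : differentiable (g i) y.
  have -> : g i = (fun N : 'rV[R]_n => N 0 i) \o grad f.
    by apply/funext => z; rewrite /= mxE.
  by apply: differentiable_comp => //; exact: differentiable_coord.
pose k (z : 'rV[R]_n) := \sum_(i < n) u 0 i * g i z.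
have kE : k = \sum_(i < n) (u 0 i \*: g i).
  by apply/funext => z; rewrite fct_sumE.
set q := dotv _ _.
have dk : is_derive y u k q.
  have -> : q = \sum_(i < n) u 0 i *: 'D_u (g i) y.
    rewrite /q /dotv; apply: eq_bigr => i _; rewrite mxE mulrC; congr (_ * _).
    by rewrite derive_rV//; apply: eq_bigr => j _; rewrite !mxE.
  rewrite kE; apply: is_derive_sum => i; apply: is_deriveZ.
  by apply/derivableP; exact: diff_derivable.
rewrite leNgt; apply/negP => q0.
have k_lim : h^-1 * (k (h *: u + y) - k y) @[h --> 0^'] --> q.
  by rewrite -(@derive_val _ _ _ _ _ _ _ dk); exact: (@ex_derive _ _ _ _ _ _ _ dk).
(* A margin of |q| / 2 keeps the difference quotients of k below q / 2 on both sides of 0. *)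
have nq : 0 < - q / 2 by rewrite divr_gt0// oppr_gt0.
move/cvgrPdist_lt : k_lim => /(_ _ nq).
rewrite near_withinE => /nbhs_ballP[e1 /= e10 k_near].
have u_cont : h *: u @[h --> (0 : R)] --> (0 : 'rV[R]_n).
  by rewrite -[X in _ --> X](scale0r u); apply: cvgZr_tmp; exact: cvg_id.
move/cvgrPdist_lt : (u_cont) => /(_ _ r0) /nbhs_ballP[e2 /= e20 u_near].
have /nbhs_ballP[r3 /= r30 df_near] := df.
move/cvgrPdist_lt : (u_cont) => /(_ _ r30) /nbhs_ballP[e3 /= e30 u_near3].
pose e := Num.min e1 (Num.min e2 e3).
have e0 : 0 < e by rewrite !lt_min e10 e20.
have e_le1 : e <= e1 by rewrite ge_min lexx.
have e_le2 : e <= e2 by rewrite !ge_min lexx orbT.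
have e_le3 : e <= e3 by rewrite !ge_min lexx !orbT.
pose s := e / 2.
have s0 : 0 < s by rewrite divr_gt0.
have se : s < e by rewrite ltr_pdivrMr// ltr_pMr// ltr1n.
have dfc c : `|c| < e -> differentiable f (y + c *: u).
  move=> ce; apply: df_near; rewrite -ball_normE/= opprD addrA subrr add0r normrN.
  have := u_near3 c; rewrite /ball/= sub0r normrN => /(_ (lt_le_trans ce e_le3)).
  by rewrite /= sub0r normrN.
pose phi c := f (y + c *: u) + f (y + c *: (- u)).
pose dphi c := k (y + c *: u) - k (y - c *: u).
have phi_der c : `|c| < e -> is_derive c (1 : R) phi (dphi c).
  move=> ce; have d1 := dfc c ce.
  have d2 : differentiable f (y + c *: (- u)).
    by rewrite scalerN -scaleNr; apply: dfc; rewrite normrN.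
  have -> : dphi c = 'D_u f (y + c *: u) + 'D_(- u) f (y + c *: (- u)).
    rewrite !derive_rV// /dphi /k scalerN; congr (_ + _).
    by rewrite -sumrN; apply: eq_bigr => i _; rewrite mxE mulNr.
  exact: is_deriveD (is_derive_line d1) (is_derive_line d2).
have cphi : {within `[0, s], continuous phi}.
  apply: derivable_within_continuous => c; rewrite in_itv/= => /andP[c0 cs].
  apply: (@ex_derive _ _ _ _ _ _ _ (phi_der c _)).
  by rewrite ger0_norm// (le_lt_trans cs).
have phi_der0 c : c \in `]0, s[ -> is_derive c (1 : R) phi (dphi c).
  rewrite in_itv/= => /andP[c0 cs]; apply: phi_der.
  by rewrite gtr0_norm// (lt_trans cs).
have [c] := MVT s0 phi_der0 cphi.
rewrite in_itv/= subr0 => /andP[c0 cs] phi_eq.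
have phi_ge0 : 0 <= phi s - phi 0.
  rewrite /phi !scale0r !addr0 scalerN.
  have := u_near s; rewrite /ball/= sub0r normrN gtr0_norm// => /(_ (lt_le_trans se e_le2)).
  rewrite sub0r normrN => /f2; rewrite mulr_natl mulr2n.
  by rewrite /=.
have ce : `|c| < e by rewrite gtr0_norm// (lt_trans cs).
have kc h : `|h| < e -> h != 0 -> h^-1 * (k (h *: u + y) - k y) < q / 2.
  move=> he h0; have := k_near h; rewrite /ball/= sub0r normrN.
  move=> /(_ (lt_le_trans he e_le1) h0); rewrite distrC => /ltr_distlDr.
  by rewrite (_ : q + - q / 2 = q / 2); last by field.
have c_neq0 : c != 0 by rewrite gt_eqF.
have := kc c ce c_neq0; rewrite ltr_pdivrMl// => k1.
(* For the negative step -c this reads k(y) - k(y - c u) < c q / 2; added to the first inequality it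
   gives [dphi c] < c q < 0. *)
have := kc (- c); rewrite normrN oppr_eq0 => /(_ ce c_neq0).
rewrite invrN mulNr ltrNl ltr_pdivlMl// => k2.
have dphi_lt0 : dphi c < 0.
  move: k1 k2; rewrite /dphi scaleNr ![_ + y]addrC => k1 k2.
  have cq : c * q < 0 by rewrite pmulr_rlt0.
  by lra.
by move: phi_ge0; rewrite phi_eq leNgt pmulr_llt0// dphi_lt0.
Qed.

End second_order.

(** The three errors count 1 + 1 + 2 = 4 times, hence the quarter in e. *)
Lemma second_difference_lt0 (R : realType) (u v w u' v' w' e : R) :
  `|u - u'| < e -> `|v - v'| < e -> `|w - w'| < e ->
  e = - (u + v - 2 * w) / 4 -> u' + v' - 2 * w' < 0.
Proof. by rewrite !ltr_norml => /andP[] ? ? /andP[] ? ? /andP[] ? ? ?; lra. Qed.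

Theorem corollary3 (R : realType) (n : nat) (t0 t1 alpha beta : R)
    (xa xb : 'rV[R]_n) (L : R -> 'rV[R]_n -> 'rV[R]_n -> R)
    (x0 : R -> 'rV[R]_n)
    (ht : t0 < t1) (halpha : 0 < alpha <= 1) (hbeta : 0 < beta)
    (hadm : admissible alpha t0 t1 xa xb x0)
    (hC1 : C1_near L (graph alpha t0 t1 x0))
    (hL2 : forall t, cont_points alpha t0 t1 x0 t ->
       twice_differentiable (L t (x0 t)) (caputo alpha t0 t1 x0 t))
    (hmin : weak_local_min alpha beta t0 t1 xa xb L x0) :
  forall t, cont_points alpha t0 t1 x0 t -> forall mu : 'rV[R]_n,
    0 <= dotv (mu *m (hessian (L t (x0 t)) (caputo alpha t0 t1 x0 t))^T) mu.
Proof.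
have [[x0_cont [psi psi_PC x0E]] x0a x0b] := hadm.
have [U [oU graphU U_C1]] := hC1.
have LU p : U p -> {for p, continuous
    (fun q : R * 'rV[R]_n * 'rV[R]_n => L q.1.1 q.1.2 q.2)}.
  by move=> /U_C1[].
have [_ [delta delta0 x0_min]] := hmin.
have [K K0 caputoE] := caputo_frac_int halpha.
have [D [D_in psi_cont psi_lim]] := psi_PC.
(* A representative of the Caputo derivative that inherits the side limits of psi; the two agree off
   [D]. *)
pose y0 s := K *: psi s.
have cap_y0 s : t0 <= s <= t1 -> s \notin D -> caputo alpha t0 t1 x0 s = y0 s.
  move=> st sD; apply: (caputoE _ _ _ _ _ ht psi_PC x0E) => //.
  exact: psi_cont.
have y0_cont s : t0 <= s <= t1 -> s \notin D -> cont_at_in t0 t1 y0 s.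
  by move=> st sD; apply: cvgZl_tmp; exact: psi_cont.
have near_cap s : \forall u \near s, t0 <= u <= t1 -> u != s -> 
    caputo alpha t0 t1 x0 u = y0 u.
  have := near_notin_seq D s; apply: filterS => u uD ut us.
  by apply: cap_y0 => //; exact: uD.
have good_points s : t0 <= s <= t1 -> s \notin D -> cont_points alpha t0 t1 x0 s.
  move=> st sD; split=> //; rewrite /cont_at_in cap_y0//.
  apply: cvg_trans (y0_cont s st sD); apply: near_eq_cvg.
  rewrite near_withinE; have := near_notin sD; apply: filterS => u uD.
  by rewrite /= in_itv/= => ut; rewrite cap_y0.
have y0_in s : t0 <= s <= t1 -> s \notin D ->
    cont_at_in t0 t1 y0 s /\ U (s, x0 s, y0 s).
  move=> st sD; split; first exact: y0_cont.
  apply: graphU; exists s, (y0 s); split=> //; left; split; last by rewrite cap_y0.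
  exact: good_points.
have near_cd s : t0 < s < t1 -> \forall u \near s, t0 <= u <= t1.
  move=> /andP[t0s st1]; near=> u.
  by apply/andP; split; apply: ltW; near: u; [exact: lt_nbhsr|exact: lt_nbhsl].
have y0_lim s : s \in D -> exists l r, [/\ y0 u @[u --> s^'-] --> l,
    y0 u @[u --> s^'+] --> r, U (s, x0 s, l) & U (s, x0 s, r)].
  move=> sD; have sin := D_in s sD.
  have [/cvg_ex[/= l psil] /cvg_ex[/= r psir]] := psi_lim s sD.
  have yl : y0 u @[u --> s^'-] --> K *: l by exact: cvgZl_tmp.
  have yr : y0 u @[u --> s^'+] --> K *: r by exact: cvgZl_tmp.
  have st : t0 <= s <= t1 by move: sin => /andP[/ltW -> /ltW].
  have cl : caputo alpha t0 t1 x0 u @[u --> s^'-] --> K *: l.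
    apply: cvg_trans yl; apply: near_eq_cvg; rewrite near_withinE.
    apply: filterS2 (near_cap s) (near_cd s sin) => u H ut us.
    by rewrite H// lt_eqF.
  have cr : caputo alpha t0 t1 x0 u @[u --> s^'+] --> K *: r.
    apply: cvg_trans yr; apply: near_eq_cvg; rewrite near_withinE.
    apply: filterS2 (near_cap s) (near_cd s sin) => u H ut us.
    by rewrite H// gt_eqF.
  (* A point of [D] may still be a continuity point of the Caputo derivative, and then both side
     limits equal its value there. Otherwise both belong to the graph by definition. *)
  have [sc|sc] := pselect (cont_points alpha t0 t1 x0 s); last first.
    exists (K *: l), (K *: r); split; [exact: yl|exact: yr|apply: graphU..].
      by exists s, (K *: l); split=> //; right; split=> //; left.
    by exists s, (K *: r); split=> //; right; split=> //; right.
  have Us : U (s, x0 s, caputo alpha t0 t1 x0 s).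
    by apply: graphU; exists s, (caputo alpha t0 t1 x0 s); split=> //; left.
  have cs : caputo alpha t0 t1 x0 u @[u --> s] --> caputo alpha t0 t1 x0 s.
    have [_ +] := sc; rewrite /cont_at_in within_interior//.
    rewrite /interior/=; apply: filterS (near_cd s sin) => u ut.
    by rewrite /= in_itv.
  have lE : K *: l = caputo alpha t0 t1 x0 s.
    exact: cvg_unique cl (cvg_at_left_filter cs).
  have rE : K *: r = caputo alpha t0 t1 x0 s.
    exact: cvg_unique cr (cvg_at_right_filter cs).
  by exists (K *: l), (K *: r); split; [exact: yl|exact: yr|rewrite lE|rewrite rE].
have x0_min' (x : R -> 'rV[R]_n) : admissible alpha t0 t1 (x0 t0) (x0 t1) x ->
    (norm_PCalpha alpha t0 t1 (fun t => x t - x0 t)%R < delta%:E)%E ->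
    functionalJ alpha beta t0 t1 L x0 <= functionalJ alpha beta t0 t1 L x.
  by rewrite x0a x0b; exact: x0_min.
have sd := @second_difference_ge0 R n t0 t1 alpha beta L x0 psi y0 U D K delta
  ht halpha hbeta oU LU x0_cont psi_PC x0E K0
  (fun phi f fPC phiE => caputoE n t0 t1 phi f ht fPC phiE)
  D_in psi_cont (fun=> erefl) y0_in y0_lim delta0 x0_min'.
move=> t t_cont mu; have [tt cap_cont] := t_cont.
set y := caputo alpha t0 t1 x0 t.
have Ut : U (t, x0 t, y).
  by apply: graphU; exists t, y; split=> //; left.
have [r r0 rP] := near_uniform oU LU Ut (@ltr01 R).
(* The first term keeps y + v and y - v in U, the second gives n |v| < delta / 4. *)
pose rho := Num.min (r / 2) (delta / (8 * (n%:R + 1))).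
have n10 : 0 < 8 * (n%:R + 1) :> R by rewrite mulr_gt0// ltr_wpDl.
have rho0 : 0 < rho by rewrite lt_min !divr_gt0.
apply: (@hessian_ge0 R n (L t (x0 t)) y rho mu rho0); first exact: hL2.
move=> v vrho.
have v_r : `|v| < r / 2 by apply: (lt_le_trans vrho); rewrite ge_min lexx.
have v_delta : n%:R * `|v| < delta / 4.
  have : `|v| < delta / (8 * (n%:R + 1)).
    by apply: (lt_le_trans vrho); rewrite ge_min lexx orbT.
  rewrite !ltr_pdivlMr//; apply: le_lt_trans.
  have -> : `|v| * (8 * (n%:R + 1)) = n%:R * `|v| * 4 + (n%:R * `|v| * 4 + 8 * `|v|).
    by ring.
  by rewrite lerDl addr_ge0 ?mulr_ge0.
have near_U w : `|w| < r / 2 -> U (t, x0 t, y + w).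
  move=> wr; have [] := rP t (x0 t) (y + w); rewrite /= ?subrr ?normr0//.
  by rewrite opprD addrA subrr add0r normrN (lt_trans wr)// ltr_pdivrMr// ltr_pMr// ltr1n.
rewrite leNgt; apply/negP => neg.
pose e := - (L t (x0 t) (y + v) + L t (x0 t) (y - v) - 2 * L t (x0 t) y) / 4.
have e0 : 0 < e by rewrite divr_gt0// oppr_gt0.
have Uv := near_U v v_r.
have Uw : U (t, x0 t, y - v) by apply: near_U; rewrite normrN.
have [r1 r10 P1] := near_uniform oU LU Uv e0.
have [r2 r20 P2] := near_uniform oU LU Uw e0.
have [r3 r30 P3] := near_uniform oU LU Ut e0.
pose m := Num.min r1 (Num.min r2 r3).
have m0 : 0 < m by rewrite !lt_min r10 r20.
have m1 : m <= r1 by rewrite ge_min lexx.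
have m2 : m <= r2 by rewrite !ge_min lexx orbT.
have m3 : m <= r3 by rewrite !ge_min lexx !orbT.
(* The point t may be an endpoint or belong to [D]. The contradiction is reached at a nearby s in
   the open interval and off [D], where the second difference is already known to be nonnegative. *)
have PF := within_dnbhs_proper ht tt.
have : \forall s \near within `[t0, t1] t^', [/\ `|t - s| < m,
    `|x0 t - x0 s| < m, `|y - caputo alpha t0 t1 x0 s| < m &
    t0 < s < t1 /\ s \notin D].
  rewrite near_withinE near_withinE.
  have H1 : \forall s \near t, `|t - s| < m.
    by near=> s; near: s; exact: cvgr_dist_lt.
  have := x0_cont; move=> /subspace_continuousP/(_ t).
  rewrite /= in_itv/= => /(_ tt)/cvgrPdist_lt/(_ _ m0).
  rewrite near_withinE => H2.
  move/cvgrPdist_lt : cap_cont => /(_ _ m0); rewrite near_withinE => H3.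
  (* Adjoining the endpoints to [D] keeps s off them; puncturing at t covers the case in which t is
     one of these points. *)
  have H4 := near_notin_seq [:: t0, t1 & D] t.
  near=> s => st s01.
  have sD : s \notin [:: t0, t1 & D] by apply: (near H4 s).
  move: sD; rewrite !inE !negb_or => /and3P[s0 s1 sD].
  split; [exact: (near H1 s)|exact: (near H2 s)|exact: (near H3 s)|split=> //].
  by move: s01; rewrite /= in_itv/= !lt_neqAle eq_sym s0 s1.
move=> /filter_ex[s [ts xs ys [st sD]]].
have st' : t0 <= s <= t1 by move: st => /andP[/ltW -> /ltW].
move: ys; rewrite cap_y0// => ys.
have yvs w : `|y + w - (y0 s + w)| < m.
  by rewrite opprD addrACA subrr addr0.
have [|||U1 E1] := P1 s (x0 s) (y0 s + v); rewrite /=.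
- exact: lt_le_trans m1.
- exact: lt_le_trans m1.
- exact: lt_le_trans (yvs v) m1.
have [|||U2 E2] := P2 s (x0 s) (y0 s - v); rewrite /=.
- exact: lt_le_trans m2.
- exact: lt_le_trans m2.
- exact: lt_le_trans (yvs (- v)) m2.
have [|||_ E3] := P3 s (x0 s) (y0 s); rewrite /=.
- exact: lt_le_trans m3.
- exact: lt_le_trans m3.
- exact: lt_le_trans m3.
have := sd s v st sD v_delta U1 U2; apply/negP; rewrite -ltNge.
exact: second_difference_lt0 E1 E2 E3 erefl.
Unshelve. all: by end_near. Qed.
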